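(* Let $\mathbb{F}$ be an arbitrary field (finite or infinite), $G$ a finite group, and let $\varepsilon:\mathbb{N}\to G$ define a $G$-grading on $\mathrm{UT}$. Then $\mathrm{Id}_G(\mathrm{UT},\varepsilon)$ is finitely based, i.e. it is generated, as an ideal of graded polynomial identities, by a finite set of polynomials.
   Context: $\mathbb{N}=\{1,2,\ldots\}$. $\mathrm{UT}$ is the associative $\mathbb{F}$-algebra with basis $\{e_{ij}\mid 1\le i\le j\}$ ($i,j\in\mathbb{N}$) and product $e_{ij}e_{k\ell}=\delta_{jk}e_{i\ell}$. A map $\varepsilon:\mathbb{N}\to G$ defines a $G$-grading on $\mathrm{UT}$ in which each $e_{ij}$ is homogeneous of degree $\varepsilon(i)\varepsilon(i+1)\cdots\varepsilon(j-1)$ (so $\deg_G e_{i,i+1}=\varepsilon(i)$ and $\deg_G e_{ii}=1$). $\mathbb{F}\langle X^G\rangle$ is the free associative unital algebra on variables $x_i^{(g)}$ ($g\in G$, $i\in\mathbb{N}$), with $\deg_G x_i^{(g)}=g$. $\mathrm{Id}_G(\mathrm{UT},\varepsilon)$ is the set of all $f(x_1^{(g_1)},\ldots,x_m^{(g_m)})\in\mathbb{F}\langle X^G\rangle$ such that $f(a_1,\ldots,a_m)=0$ for all $a_i$ in the homogeneous component of degree $g_i$ of $\mathrm{UT}$ with the grading defined by $\varepsilon$ (constant terms are evaluated in the unitization of $\mathrm{UT}$). The ideal of graded polynomial identities generated by a set is the smallest two-sided ideal of $\mathbb{F}\langle X^G\rangle$ containing it and invariant under all degree-preserving algebra endomorphisms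 of $\mathbb{F}\langle X^G\rangle$. *)

(* Defs.v *)
From HB Require Import structures.
From mathcomp Require Import all_boot all_order all_algebra all_fingroup.
From mathcomp Require Import finmap.
From mathcomp.multinomials Require Import monalg.

Set Implicit Arguments.
Unset Strict Implicit.
Unset Printing Implicit Defensive.

Import GRing.Theory.
Local Open Scope ring_scope.

Section Unitization.
Variables (F : fieldType) (V : lmodType F) (m : V -> V -> V).

(* The pair (x, a) stands for x + a in the unitization F + V. *)
Definition unitz_mul (u v : F^o * V) : F^o * V :=
  (u.1 * v.1, u.1 *: v.2 + v.1 *: u.2 + m u.2 v.2).

Hypotheses (mA : associative m) (mDl : left_distributive m +%R)
  (mDr : right_distributive m +%R).
Hypotheses (mZl : forall x a b, m (x *: a) b = x *: m a b)
  (mZr : forall x a b, m a (x *: b) = x *: m a b).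

Let m0l (b : V) : m 0 b = 0.
Proof. by rewrite -(scale0r 0) mZl !scale0r. Qed.
Let m0r (a : V) : m a 0 = 0.
Proof. by rewrite -(scale0r 0) mZr !scale0r. Qed.

Lemma unitz_mulA : associative unitz_mul.
Proof.
move=> [x a] [y b] [z c]; rewrite /unitz_mul /=; congr (_, _).
  exact: mulrA.
rewrite !(scalerDr, mDl, mDr, mZl, mZr, scalerA) mA.
rewrite [z * x]mulrC [z * y]mulrC -!addrA; congr (_ + _); congr (_ + _).
rewrite addrCA; congr (_ + _); rewrite [RHS]addrCA; congr (_ + _).
exact: addrCA.
Qed.

Lemma unitz_mul1l : left_id (1, 0) unitz_mul.
Proof.
by move=> [x a]; rewrite /unitz_mul /= mul1r scale1r scaler0 m0l !addr0.
Qed.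

Lemma unitz_mul1r : right_id (1, 0) unitz_mul.
Proof.
by move=> [x a]; rewrite /unitz_mul /= mulr1 scale1r scaler0 m0r addr0 add0r.
Qed.

Lemma unitz_mulDl : left_distributive unitz_mul +%R.
Proof.
move=> [x a] [y b] [z c]; congr (_, _) => /=; first exact: mulrDl.
rewrite scalerDl scalerDr mDl [RHS]addrACA; congr (_ + _); exact: addrACA.
Qed.

Lemma unitz_mulDr : right_distributive unitz_mul +%R.
Proof.
move=> [x a] [y b] [z c]; congr (_, _) => /=; first exact: mulrDr.
rewrite scalerDl scalerDr mDr [RHS]addrACA; congr (_ + _); exact: addrACA.
Qed.

Lemma unitz_scaleAl (c : F) (u v : F^o * V) :
  c *: unitz_mul u v = unitz_mul (c *: u) v.
Proof.
congr (_, _) => /=; first exact: mulrA.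
by rewrite !scalerDr mZl !scalerA [c * v.1]mulrC.
Qed.

Lemma unitz_scaleAr (c : F) (u v : F^o * V) :
  c *: unitz_mul u v = unitz_mul u (c *: v).
Proof.
congr (_, _) => /=; first exact: mulrCA.
by rewrite !scalerDr mZr !scalerA [c * u.1]mulrC.
Qed.

End Unitization.

(* [UTidx] indexes the basis e_{ij}, i <= j.  Rows and columns are numbered
   from 0, so e_{ij} here is e_{i+1,j+1} in the numbering from 1, and the map
   [eps] below is shifted in the same way. *)
Record UTidx : predArgType :=
  UTIdx { UTpair : nat * nat; _ : (UTpair.1 <= UTpair.2)%N }.
HB.instance Definition _ := [isSub for UTpair].
HB.instance Definition _ := [Choice of UTidx by <:].

Definition UTrow (p : UTidx) : nat := (UTpair p).1.
Definition UTcol (p : UTidx) : nat := (UTpair p).2.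

Lemma UTidx_comp (p q : UTidx) : UTcol p = UTrow q -> (UTrow p <= UTcol q)%N.
Proof.
by move=> epq; apply: leq_trans (valP p) _; rewrite -/(UTcol p) epq (valP q).
Qed.

Notation UT F := {malg F[UTidx]}.

Section UT.
Variable F : fieldType.

Definition UTe (i j : nat) (le_ij : (i <= j)%N) : UT F :=
  << @UTIdx (i, j) le_ij >>.

Definition UTmul_basis (p q : UTidx) : UT F :=
  if @eqP _ (UTcol p) (UTrow q) is ReflectT epq
  then UTe (UTidx_comp epq) else 0.

Definition UTmul (a b : UT F) : UT F :=
  \sum_(p <- msupp a) \sum_(q <- msupp b) (a@_p * b@_q) *: UTmul_basis p q.

Lemma UTmulEw (d1 d2 : {fset UTidx}) (a b : UT F) :
  (msupp a `<=` d1)%fset -> (msupp b `<=` d2)%fset ->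
  UTmul a b = \sum_(p <- d1) \sum_(q <- d2) (a@_p * b@_q) *: UTmul_basis p q.
Proof.
move=> le1 le2; rewrite /UTmul (big_fset_incl _ le1) /=.
  apply/eq_bigr=> p _; apply/big_fset_incl => // q _ /mcoeff_outdom ->.
  by rewrite mulr0 scale0r.
move=> p _ /mcoeff_outdom ap0.
by rewrite big1 // => q _; rewrite ap0 mul0r scale0r.
Qed.

Lemma UTmulDl : left_distributive UTmul +%R.
Proof.
move=> a b c.
rewrite (UTmulEw (msuppD_le a b) (fsubset_refl _)).
rewrite (UTmulEw (fsubsetUl _ (msupp b)) (fsubset_refl (msupp c))).
rewrite (UTmulEw (fsubsetUr (msupp a) _) (fsubset_refl (msupp c))).
rewrite -big_split /=; apply/eq_bigr=> p _.
rewrite -big_split /=; apply/eq_bigr=> q _.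
by rewrite mcoeffD mulrDl scalerDl.
Qed.

Lemma UTmulDr : right_distributive UTmul +%R.
Proof.
move=> c a b.
rewrite (UTmulEw (fsubset_refl _) (msuppD_le a b)).
rewrite (UTmulEw (fsubset_refl (msupp c)) (fsubsetUl _ (msupp b))).
rewrite (UTmulEw (fsubset_refl (msupp c)) (fsubsetUr (msupp a) _)).
rewrite -big_split /=; apply/eq_bigr=> p _.
rewrite -big_split /=; apply/eq_bigr=> q _.
by rewrite mcoeffD mulrDr scalerDl.
Qed.

Lemma UTmul0l : left_zero 0 UTmul.
Proof. by move=> a; rewrite /UTmul msupp0 big_seq_fset0. Qed.

Lemma UTmul0r : right_zero 0 UTmul.
Proof.
by move=> a; rewrite /UTmul msupp0; apply: big1 => p _; rewrite big_seq_fset0.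
Qed.

Lemma UTmulZl (x : F) (a b : UT F) : UTmul (x *: a) b = x *: UTmul a b.
Proof.
rewrite (UTmulEw (msuppZ_le x a) (fsubset_refl _)) /UTmul scaler_sumr.
apply/eq_bigr=> p _; rewrite scaler_sumr; apply/eq_bigr=> q _.
by rewrite mcoeffZ scalerA mulrA.
Qed.

Lemma UTmulZr (x : F) (a b : UT F) : UTmul a (x *: b) = x *: UTmul a b.
Proof.
rewrite (UTmulEw (fsubset_refl _) (msuppZ_le x b)) /UTmul scaler_sumr.
apply/eq_bigr=> p _; rewrite scaler_sumr; apply/eq_bigr=> q _.
by rewrite mcoeffZ scalerA mulrCA.
Qed.

Lemma UTmulUU (p q : UTidx) : UTmul << p >> << q >> = UTmul_basis p q.
Proof.
rewrite (UTmulEw msuppU_le msuppU_le) !big_seq_fset1.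
by rewrite !mcoeffUU mulr1 scale1r.
Qed.

Lemma UTmul_e_eq (i j l : nat) (le_ij : (i <= j)%N) (le_jl : (j <= l)%N)
    (le_il : (i <= l)%N) :
  UTmul (UTe le_ij) (UTe le_jl) = UTe le_il.
Proof.
rewrite UTmulUU /UTmul_basis; case: eqP => // epq.
by congr (<< _ >>); apply/val_inj.
Qed.

Lemma UTmul_e_neq (i j k l : nat) (le_ij : (i <= j)%N) (le_kl : (k <= l)%N) :
  j != k -> UTmul (UTe le_ij) (UTe le_kl) = 0.
Proof.
by rewrite UTmulUU /UTmul_basis => /eqP njk; case: eqP => // ejk; case: njk.
Qed.

Lemma UTdecomp (a : UT F) : a = \sum_(p <- msupp a) a@_p *: (<< p >> : UT F).
Proof.
rewrite {1}[a]monalgE; apply/eq_bigr=> p _; apply/malgP=> q.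
by rewrite mcoeffZ !mcoeffU mulrnAr mulr1.
Qed.

Lemma UTmul_suml (I : Type) (r : seq I) (a : I -> UT F) (b : UT F) :
  UTmul (\sum_(i <- r) a i) b = \sum_(i <- r) UTmul (a i) b.
Proof.
exact: (big_morph (UTmul^~ b) (fun _ _ => UTmulDl _ _ _) (UTmul0l _)).
Qed.

Lemma UTmul_sumr (I : Type) (r : seq I) (a : UT F) (b : I -> UT F) :
  UTmul a (\sum_(i <- r) b i) = \sum_(i <- r) UTmul a (b i).
Proof.
exact: (big_morph (UTmul a) (fun _ _ => UTmulDr _ _ _) (UTmul0r _)).
Qed.

Lemma UTmulA_basis (p q r : UTidx) :
  UTmul << p >> (UTmul << q >> << r >>) = UTmul (UTmul << p >> << q >>) << r >>.
Proof.
case: p q r => [[i j] /= ij] [[k l] /= kl] [[m n] /= mn].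
rewrite -![mkmalgU (UTIdx _) _]/(UTe _).
have [ejk|njk] := eqVneq j k; last first.
  rewrite (UTmul_e_neq _ _ njk) UTmul0l.
  have [elm|nlm] := eqVneq l m; last by rewrite (UTmul_e_neq _ _ nlm) UTmul0r.
  subst m; have kn := leq_trans kl mn.
  by rewrite (UTmul_e_eq _ _ kn) (UTmul_e_neq _ _ njk).
subst k; have il := leq_trans ij kl; rewrite (UTmul_e_eq _ _ il).
have [elm|nlm] := eqVneq l m; last by rewrite !(UTmul_e_neq _ _ nlm) UTmul0r.
subst m; have jn := leq_trans kl mn; have i_n := leq_trans ij jn.
by rewrite (UTmul_e_eq _ _ jn) !(UTmul_e_eq _ _ i_n).
Qed.

Lemma UTmulA : associative UTmul.
Proof.
move=> a b c; rewrite (UTdecomp a).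
rewrite (UTmul_suml _ _ (UTmul b c)) (UTmul_suml _ _ b) (UTmul_suml _ _ c).
apply: eq_bigr => p _; rewrite !UTmulZl; congr (_ *: _).
rewrite (UTdecomp b) (UTmul_suml _ _ c) !(UTmul_sumr _ << p >>).
rewrite (UTmul_suml _ _ c); apply: eq_bigr => q _.
rewrite UTmulZl !UTmulZr UTmulZl; congr (_ *: _).
rewrite (UTdecomp c) (UTmul_sumr _ << q >>) (UTmul_sumr _ << p >>).
rewrite (UTmul_sumr _ (UTmul << p >> << q >>)); apply: eq_bigr => r _.
by rewrite !UTmulZr UTmulA_basis.
Qed.

Definition UT1 : Type := (F^o * UT F)%type.
HB.instance Definition _ := GRing.Lmodule.on UT1.

Definition UT1one : UT1 := (1, 0).
Definition UT1mul : UT1 -> UT1 -> UT1 := unitz_mul UTmul.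

Lemma UT1one_neq0 : UT1one != 0.
Proof. by apply/eqP=> -[/eqP]; rewrite oner_eq0. Qed.

HB.instance Definition _ := GRing.Zmodule_isNzRing.Build UT1
  (unitz_mulA UTmulA UTmulDl UTmulDr UTmulZl UTmulZr)
  (unitz_mul1l UTmulZl) (unitz_mul1r UTmulZr)
  (unitz_mulDl UTmulDl) (unitz_mulDr UTmulDr) UT1one_neq0.
HB.instance Definition _ := GRing.Lmodule_isLalgebra.Build F UT1
  (unitz_scaleAl UTmulZl).
HB.instance Definition _ := GRing.Lalgebra_isAlgebra.Build F UT1
  (unitz_scaleAr UTmulZr).

Definition UTincl (a : UT F) : UT1 := (0, a).

End UT.

(* For a free module with basis K and a degree map d on K: membership in the
   homogeneous component of degree g, the span of the basis elements of
   degree g. *)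
Definition homogeneous (K : choiceType) (V : zmodType) (gT : eqType)
    (d : K -> gT) (g : gT) (a : {malg V[K]}) : bool :=
  all (fun k => d k == g) (msupp a).

Definition UTdeg (gT : finGroupType) (eps : nat -> gT) (p : UTidx) : gT :=
  (\prod_(UTrow p <= k < UTcol p) eps k)%g.

(* F<X^G>: the variable x_i^(g) is the pair (g, i). *)
Notation freeMon gT := {fmonom (gT * nat)%type}.
Notation freeAlg F gT := {malg F[freeMon gT]}.

Section GradedFree.
Variables (F : fieldType) (gT : finGroupType).

Definition wdeg (w : freeMon gT) : gT := (\prod_(x <- fmonom_val w) x.1)%g.

Definition UTeval (a : gT * nat -> UT F) : freeAlg F gT -> UT1 F :=
  mmap (in_alg (UT1 F))
       (fun w : freeMon gT => \prod_(x <- fmonom_val w) UTincl (a x)).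

Definition IdG (eps : nat -> gT) (f : freeAlg F gT) : Prop :=
  forall a : gT * nat -> UT F,
    (forall g i, homogeneous (UTdeg eps) g (a (g, i))) -> UTeval a f = 0.

Definition degree_preserving (phi : freeAlg F gT -> freeAlg F gT) : Prop :=
  forall g f, homogeneous wdeg g f -> homogeneous wdeg g (phi f).

(* Closure under opposites follows from [graded_T_ideal_mull] with -1. *)
Record graded_T_ideal (I : freeAlg F gT -> Prop) : Prop := GradedTIdeal {
  graded_T_ideal0 : I 0;
  graded_T_idealD : forall f h, I f -> I h -> I (f + h);
  graded_T_ideal_mull : forall f h, I f -> I (h * f);
  graded_T_ideal_mulr : forall f h, I f -> I (f * h);
  graded_T_ideal_endo : forall phi : {lrmorphism freeAlg F gT -> freeAlg F gT},
    degree_preserving phi -> forall f, I f -> I (phi f)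
}.

Definition graded_T_ideal_gen (S : freeAlg F gT -> Prop)
    (f : freeAlg F gT) : Prop :=
  forall I, graded_T_ideal I -> (forall s, S s -> I s) -> I f.

Lemma graded_T_ideal_genP (S : freeAlg F gT -> Prop) :
  graded_T_ideal (graded_T_ideal_gen S).
Proof.
split=> [I II _ | f h Hf Hh I II SI | f h Hf I II SI | f h Hf I II SI
        | phi dphi f Hf I II SI].
- exact: graded_T_ideal0 II.
- by apply: (graded_T_idealD II); [apply: Hf | apply: Hh].
- by apply: (graded_T_ideal_mull II); apply: Hf.
- by apply: (graded_T_ideal_mulr II); apply: Hf.
- by apply: (graded_T_ideal_endo II) => //; apply: Hf.
Qed.

End GradedFree.

(* Main.v *)
From HB Require Import structures.
From Stdlib Require Import Classical.
Require Import Defs.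
From mathcomp Require Import all_boot all_order all_algebra all_fingroup.
From mathcomp Require Import finmap.
From mathcomp.multinomials Require Import monalg.

(** A word in the graded variables is evaluated on UT along weakly increasing
    paths of row indices: a variable of degree 1 may stay at an index, where it
    contributes a diagonal entry, and all other steps increase the index.  Put
    p_n = eps 0 * ... * eps (n-1), so that e_ij has degree p_i^-1 * p_j.  The
    degrees of the steps of a strict path form a word over G; the words that
    occur, called realizable below, are those whose sequence of partial
    products is, up to a left translation, a subsequence of the infinite word
    p.

    If f_1, ..., f_s are homogeneous of degrees g_1, ..., g_s and all their
    values have zero diagonal, then f_1 * ... * f_s is an identity whenever
    g_1 ... g_s is not realizable.  The theorem holds because such products
    generate all identities, and because finitely many of them are enough.

    They generate ([path_coef_kernel]).  Read a word from the left and keep the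
    prefix read so far in commutative normal form (letters of degree 1 sorted,
    exponents below q if F has q elements; a letter of another degree kills the
    prefix).  Telescoping over the prefixes writes any f as a combination of
    normal words plus a sum of terms d * r, where each d is a defect: a normal
    word times a letter, minus its normal form, hence an element with zero
    diagonal.  Normal words are linearly independent as functions of the
    diagonal.  So if the coefficients of f along all realizable strict paths
    vanish, which holds for identities because matrices supported on one path
    isolate its coefficient ([IdG_path_coef]), then the normal part of f
    vanishes and each cofactor r inherits the hypothesis for the paths whose
    first step is that of d.  Iterating, f becomes a sum of products of defects
    with non-realizable degree words.

    Finitely many are enough.  From some index on, every letter of p that
    occurs recurs forever; hence a word that is not a subsequence of p contains
    one of bounded length with this property ([short_nonembedding]), and the
    same works for all translates of p at once.  For degree words, passing to a
    subsequence of the partial products means multiplying adjacent factors, so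
    a non-realizable product of defects is a multiple of a non-realizable
    product of boundedly many blocks.  A block of degree g is an arbitrary
    element of degree g when g <> 1; when g = 1 it is a sum of elements of the
    forms (ab - ba)c, (a^q - a)c, and ab with a, b of degrees h, h^-1, h <> 1
    ([block_instance_sum]).  The finitely many products of at most K such
    expressions in independent variables that are identities therefore form a
    basis. *)

Set Implicit Arguments.
Unset Strict Implicit.
Unset Printing Implicit Defensive.

Import GRing.Theory.
Local Open Scope ring_scope.

(** * Words and substitutions in the free algebra *)

Section FreeAlgebra.
Variables (F : fieldType) (gT : finGroupType).
Local Notation X := (gT * nat)%type.
Local Notation A := (freeAlg F gT).

Definition mono (w : seq X) : A := << FMonom w >>.
Definition var (x : X) : A := mono [:: x].

Lemma mono_nil : mono [::] = 1.
Proof. by rewrite /mono -fmoneE. Qed.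

Lemma mono_cat u v : mono (u ++ v) = mono u * mono v.
Proof.
by rewrite /mono malgM_def fgmulUU mulr1 /mmul /= fmmulE.
Qed.

Lemma mono_cons x w : mono (x :: w) = var x * mono w.
Proof. exact: (mono_cat [:: x]). Qed.

Lemma monoE (f : A) : f = \sum_(w <- msupp f) f@_w *: mono (fmonom_val w).
Proof.
rewrite {1}[f]monalgE; apply: eq_bigr => w _; apply/malgP => v.
by rewrite mcoeffZ !mcoeffU fmK mulrnAr mulr1.
Qed.

Lemma freeAlg_scaleAr (c : F) (f h : A) : c *: (f * h) = f * (c *: h).
Proof.
have EM := mcoeffMlw _ (fsubset_refl (msupp f)) (fsubset_refl (msupp h)).
have EZ := mcoeffMlw _ (fsubset_refl (msupp f)) (msuppZ_le c h).
apply/malgP => w; rewrite mcoeffZ [RHS]EZ [X in _ * X]EM mulr_sumr.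
apply: eq_bigr => u _; rewrite mulr_sumr; apply: eq_bigr => v _.
by rewrite mcoeffZ mulrnAr mulrCA.
Qed.

Section Subst.
Variables (S : lalgType F) (u : X -> S).
Hypothesis scaleAr : forall c (s t : S), c *: (s * t) = s * (c *: t).

Definition subst : A -> S :=
  mmap (in_alg S) (fun w : freeMon gT => \prod_(x <- fmonom_val w) u x).

HB.instance Definition _ := GRing.Additive.on subst.

Lemma subst_mono w : subst (mono w) = \prod_(x <- w) u x.
Proof. by rewrite /subst /mono mmapU /= scale1r mul1r. Qed.

Lemma subst_var x : subst (var x) = u x.
Proof. by rewrite subst_mono big_seq1. Qed.

Lemma substE f : subst f = \sum_(w <- msupp f) f@_w *: \prod_(x <- fmonom_val w) u x.
Proof. by apply: eq_bigr => w _; rewrite -scalerAl mul1r. Qed.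

Lemma subst_mmorph :
  mmorphism (fun w : freeMon gT => \prod_(x <- fmonom_val w) u x).
Proof. by split => [v w|]; rewrite ?fmM ?big_cat ?fm1 ?big_nil. Qed.

Let h : {mmorphism freeMon gT -> S} :=
  HB.pack (fun w : freeMon gT => \prod_(x <- fmonom_val w) u x)
    (isMultiplicative.Build _ _ _ subst_mmorph).

Fact subst_multiplicative : multiplicative subst.
Proof.
apply: (@commr_mmap_is_multiplicative _ _ _ _ h) => g m m'.
by rewrite /GRing.comm /= -scalerAl mul1r -scaleAr mulr1.
Qed.

Fact subst_scalable : scalable subst.
Proof.
by move=> c f; rewrite /subst (@mmapZ _ _ _ (in_alg S) h) /= -scalerAl mul1r.
Qed.

Definition subst_lr : {lrmorphism A -> S} :=
  HB.pack subst
    (GRing.isMultiplicative.Build A S subst subst_multiplicative)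
    (GRing.isScalable.Build F A S *:%R subst subst_scalable).

End Subst.

Lemma subst_lrmorph (S : lalgType F) (phi : {lrmorphism A -> S}) f :
  phi f = subst (fun x => phi (var x)) f.
Proof.
rewrite substE {1}[f]monoE linear_sum; apply: eq_bigr => w _.
rewrite linearZ /=; congr (_ *: _); elim: (fmonom_val w) => [|x v IH].
  by rewrite mono_nil rmorph1 big_nil.
by rewrite mono_cons rmorphM /= IH big_cons.
Qed.

(** * Homogeneous elements *)

Local Notation hom g f := (homogeneous (@wdeg gT) g (f : A)).

Definition degw (w : seq X) : gT := (\prod_(x <- w) x.1)%g.

Lemma degw_cat u v : degw (u ++ v) = (degw u * degw v)%g.
Proof. exact: big_cat. Qed.

Lemma homP g f : reflect (forall w, f@_w != 0 -> wdeg w = g) (hom g f).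
Proof.
apply: (iffP allP) => H w; first by rewrite mcoeff_neq0 => /H/eqP.
by rewrite -mcoeff_neq0 => /H ->.
Qed.

Lemma hom0 g : hom g 0.
Proof. by apply/homP => w; rewrite mcoeff0 eqxx. Qed.

Lemma homD g f h : hom g f -> hom g h -> hom g (f + h).
Proof.
move=> /homP Hf /homP Hh; apply/homP => w; rewrite mcoeffD.
have [f0|/Hf //] := eqVneq f@_w 0; have [h0|/Hh //] := eqVneq h@_w 0.
by rewrite f0 h0 addr0 eqxx.
Qed.

Lemma hom_sum g (I : eqType) (r : seq I) (E : I -> A) :
  (forall i, i \in r -> hom g (E i)) -> hom g (\sum_(i <- r) E i).
Proof.
elim: r => [|i r IH] H; first by rewrite big_nil hom0.
rewrite big_cons homD ?H ?mem_head // IH // => j jr.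
by rewrite H // inE jr orbT.
Qed.

Lemma homZ g c f : hom g f -> hom g (c *: f).
Proof.
move=> /homP Hf; apply/homP => w; rewrite mcoeffZ => nz; apply: Hf.
by apply: contraNneq nz => ->; rewrite mulr0.
Qed.

Lemma homN g f : hom g f -> hom g (- f).
Proof. by rewrite -scaleN1r; exact: homZ. Qed.

Lemma hom_mono w : hom (degw w) (mono w).
Proof.
apply/homP => v; rewrite /mono mcoeffU1.
by case: (FMonom w =P v) => [<-|]; rewrite ?eqxx.
Qed.

Lemma hom_var g i : hom g (var (g, i)).
Proof. by have := hom_mono [:: (g, i)]; rewrite /degw big_seq1. Qed.

Lemma homM g g' f h : hom g f -> hom g' h -> hom (g * g')%g (f * h).
Proof.
move=> /allP Hf /allP Hh; rewrite [f]monoE [h]monoE mulr_suml.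
apply: hom_sum => u fu; rewrite mulr_sumr; apply: hom_sum => v hv.
rewrite -scalerAl -freeAlg_scaleAr -mono_cat; do 2![apply: homZ].
rewrite -(eqP (Hf _ fu)) -(eqP (Hh _ hv)).
have -> : (wdeg u * wdeg v)%g = degw (fmonom_val u ++ fmonom_val v).
  by rewrite degw_cat.
exact: hom_mono.
Qed.

Lemma hom1 : hom 1%g 1.
Proof. by have := hom_mono [::]; rewrite mono_nil /degw big_nil. Qed.

Lemma homMr g f h : hom g f -> hom 1%g h -> hom g (f * h).
Proof. by move=> Hf Hh; have := homM Hf Hh; rewrite mulg1. Qed.

Lemma subst_degree_preserving (u : X -> A) :
  (forall x, hom x.1 (u x)) -> degree_preserving (subst u).
Proof.
move=> Hu g f /allP Hf; rewrite substE; apply: hom_sum => w /Hf /eqP <-.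
apply: homZ; rewrite /wdeg; elim: (fmonom_val w) => [|x v IH].
  by rewrite !big_nil hom1.
by rewrite !big_cons homM.
Qed.

End FreeAlgebra.

(** * Subsequences of an infinite word *)

Section Embedding.
Local Open Scope nat_scope.
Variable T : finType.
Implicit Types (p : nat -> T) (w : seq T).

Fixpoint embeds p n w : Prop :=
  if w is a :: w' then exists m, [/\ n <= m, p m = a & embeds p m.+1 w']
  else True.

Lemma embeds_leq p m n w : m <= n -> embeds p n w -> embeds p m w.
Proof.
case: w => // a w mn [k [nk pk kw]]; exists k; split=> //; exact: leq_trans nk.
Qed.

Lemma embeds_subseq p n v w : subseq v w -> embeds p n w -> embeds p n v.
Proof.
elim: w v n => [|a w IH] [|b v] n //= vw [m [nm pm mw]].
move: vw; case: eqP => [->|_] vw; first by exists m; split=> //; exact: IH mw.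
exact: (embeds_leq (leqW nm) (IH (b :: v) _ vw mw)).
Qed.

(** Each of the finitely many letters occurs infinitely often or not beyond
    some index; take the largest of these indices. *)
Lemma recurrent_tail p :
  exists N, forall n k, N <= n -> exists2 m, k <= m & p m = p n.
Proof.
suff [N HN] : exists N, forall a, a \in enum T ->
    (forall k, exists2 m, k <= m & p m = a) \/ (forall n, N <= n -> p n <> a).
  exists N => n k Nn; have [|H|H] := HN (p n); first by rewrite mem_enum.
    exact: H.
  by have := H _ Nn.
elim: (enum T) => [|a s [N HN]]; first by exists 0.
have [H|/not_all_ex_not [k H]] :=
  classic (forall k, exists2 m, k <= m & p m = a).
  by exists N => b; rewrite inE => /predU1P [->|/HN //]; left.
exists (maxn N k) => b; rewrite inE => /predU1P [->|/HN [Hb|Hb]].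
- right=> n; rewrite geq_max => /andP [_ kn] pn; apply: H; by exists n.
- by left.
- by right=> n; rewrite geq_max => /andP [Nn _]; apply: Hb.
Qed.

(** Let N be the index from which all letters recur.  From N on, a word fails
    to embed only because of a single letter that no longer occurs.  Going down
    from N, each index costs at most one more letter of the bad subword. *)
Lemma short_nonembedding p : exists K, forall w, ~ embeds p 0 w ->
  exists v, [/\ subseq v w, size v <= K & ~ embeds p 0 v].
Proof.
have [N HN] := recurrent_tail p; exists N.+1.
suff H k : forall n w, n + k = N -> ~ embeds p n w ->
    exists v, [/\ subseq v w, size v <= k.+1 & ~ embeds p n v].
  by move=> w; exact: (H N).
elim: k => [|k IH] n w nk nw.
  rewrite addn0 in nk; subst n.
  suff [a aw Na] : exists2 a, a \in w & forall m, N <= m -> p m <> a.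
    exists [:: a]; rewrite sub1seq; split=> // -[m [Nm pm _]]; exact: (Na m).
  apply: NNPP => H; apply: nw; move: {2 3}N (leqnn N) => n Nn.
  elim: w n Nn H => [|a w IHw] n Nn H //=.
  have [m Nm pm] : exists2 m, N <= m & p m = a.
    apply: NNPP => Ha; apply: H; exists a; rewrite ?mem_head // => m Nm pm.
    by apply: Ha; exists m.
  have [m' nm' pm'] := HN m n Nm; exists m'; split=> //; first by rewrite pm'.
  apply: IHw; first exact: leq_trans (leqW nm').
  by move=> [b bw Hb]; apply: H; exists b; rewrite // inE bw orbT.
case: w nw => [|a w] nw; first by case: (nw Logic.I).
have nk' : n.+1 + k = N by rewrite addSnnS.
have [pa|pa] := eqVneq (p n) a.
  have [|v [vw sv nv]] := IH n.+1 w nk'.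
    by move=> H; apply: nw; exists n.
  exists (a :: v); split=> //=; first by rewrite eqxx.
  by move=> [m [nm pm mv]]; apply: nv; exact: embeds_leq mv.
have skip x v : x != p n -> ~ embeds p n.+1 (x :: v) -> ~ embeds p n (x :: v).
  move=> xp nv [m [nm pm mv]]; apply: nv; exists m; split=> //.
  by rewrite ltn_neqAle nm andbT; apply: contraNneq xp => ->; rewrite pm.
have [|v [vw sv nv]] := IH n.+1 (a :: w) nk'.
  by move=> H; apply: nw; exact: embeds_leq H.
case: v vw sv nv => [|b v] vw sv nv; first by case: (nv Logic.I).
move: vw => /=; case: (b =P a) => [ba|_] vw.
  by exists (b :: v); rewrite /= ba eqxx; split=> //; [exact: leqW|];
    rewrite -ba; apply: skip; rewrite // ba eq_sym.
exists [:: a, b & v]; split; rewrite /= ?eqxx //.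
apply: (skip a (b :: v)); first by rewrite eq_sym.
move=> [m [nm pm mv]]; apply: nv.
by apply: (@embeds_leq _ _ m.+1) => //; exact: leqW.
Qed.

Lemma subseq_union (u v w : seq T) : subseq u w -> subseq v w ->
  exists t, [/\ subseq t w, subseq u t, subseq v t & size t <= size u + size v].
Proof.
elim: w u v => [|a w IH] u v.
  by rewrite !subseq0 => /eqP -> /eqP ->; exists [::].
have peel s : subseq s (a :: w) -> exists2 s', subseq s' w & s = a :: s' \/ s = s'.
  case: s => [|x s] /=; first by exists [::]; rewrite ?sub0seq //; right.
  by case: eqP => [->|_] H; [exists s => //; left | exists (x :: s) => //; right].
move=> /peel [u' uw eu] /peel [v' vw ev].
have [t [tw ut vt st]] := IH u' v' uw vw.
have up s : subseq s t -> subseq s (a :: t).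
  by move=> H; apply: subseq_trans H (subseq_cons _ _).
have both s s' : subseq s s' -> subseq (a :: s) (a :: s') by rewrite /= eqxx.
case: eu ev => -> [] ->; [| | |by exists t; split=> //; exact: subseq_trans tw (subseq_cons _ _)];
  exists (a :: t); split; rewrite ?both ?up //= ?addSn ?addnS ltnS ?leqW //.
Qed.

(** The union of bad subwords, one for each [i], is bad for every [i]. *)
Lemma short_common_nonembedding (I : finType) (p : I -> nat -> T) :
  exists K, forall w, (forall i, ~ embeds (p i) 0 w) ->
  exists v, [/\ subseq v w, size v <= K & forall i, ~ embeds (p i) 0 v].
Proof.
suff [K HK] : exists K, forall w, (forall i, ~ embeds (p i) 0 w) ->
    exists v, [/\ subseq v w, size v <= K &
      forall i, i \in enum I -> ~ embeds (p i) 0 v].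
  exists K => w /HK [v [vw sv Hv]]; exists v; split=> // i.
  by apply: Hv; rewrite mem_enum.
elim: (enum I) => [|i s [K HK]].
  by exists 0 => w _; exists [::]; rewrite sub0seq.
have [L HL] := short_nonembedding (p i).
exists (L + K) => w Hw; have [u [uw su Hu]] := HL w (Hw i).
have [v [vw sv Hv]] := HK w Hw.
have [t [tw ut vt st]] := subseq_union uw vw; exists t; split=> //.
  exact: leq_trans st (leq_add su sv).
move=> j; rewrite inE => /predU1P [->|/Hv nv] Ht.
  by apply: Hu; exact: embeds_subseq ut Ht.
by apply: nv; exact: embeds_subseq vt Ht.
Qed.

End Embedding.

(** * Polynomial functions over an arbitrary field *)

Lemma uniq_seq_of_infinite (T : eqType) :
  ~ (exists s : seq T, forall x, x \in s) ->
  forall n, exists s : seq T, uniq s /\ size s = n.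
Proof.
move=> infT; elim=> [|n [s [Us <-]]]; first by exists [::].
have [x xs] : exists x, x \notin s.
  apply: NNPP => H; apply: infT; exists s => x; apply: contraT => xs.
  by case: H; exists x.
by exists (x :: s); rewrite /= xs.
Qed.

(** Multiplication by [c <> 0] permutes the nonzero elements, so the power of
    [c] of their number is 1. *)
Lemma finite_field_expr_card (F : fieldType) (s : seq F) :
  uniq s -> (forall x, x \in s) -> forall c : F, c ^+ size s = c.
Proof.
move=> Us Ss c; have [->|c0] := eqVneq c 0.
  by rewrite expr0n; case: s {Us} Ss => // /(_ 0).
pose t := [seq x <- s | x != 0].
have nz : \prod_(x <- t) x != 0.
  rewrite prodf_seq_neq0; apply/allP => x; rewrite mem_filter => /andP [x0 _].
  by rewrite x0.
have perm_t : perm_eq [seq c * x | x <- t] t.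
  have Ut : uniq t by rewrite filter_uniq.
  have inj := mulfI c0.
  apply: uniq_perm; rewrite ?(map_inj_uniq inj) // => x.
  have -> : x = c * (c^-1 * x) by rewrite mulrA divff ?mul1r.
  rewrite mem_map // !mem_filter !Ss !andbT.
  by rewrite !mulf_eq0 invr_eq0 (negPf c0).
have ct : c ^+ size t = 1.
  apply: (mulIf nz); rewrite mul1r -{2}(perm_big _ perm_t) /= big_map.
  by rewrite big_split /= big_const_seq count_predT iter_mulr mulr1.
have -> : size s = (size t).+1.
  rewrite -(count_predC (pred1 0) s) count_uniq_mem // Ss add1n.
  by rewrite size_filter.
by rewrite exprS ct mulr1.
Qed.

(** One statement for finite and infinite fields: [q] is the cardinality of a
    finite [F], and [q = 0] encodes that [F] is infinite, with no bound on the
    degree of polynomials determined by their values. *)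
Lemma field_exponent (F : fieldType) : exists q, [/\ q != 1%N,
    q != 0%N -> forall c : F, c ^+ q = c &
    forall p : {poly F}, (q != 0%N -> (size p <= q)%N) ->
      (forall c, p.[c] = 0) -> p = 0].
Proof.
have vanish (s : seq F) (p : {poly F}) :
    uniq s -> (size p <= size s)%N -> (forall c, p.[c] = 0) -> p = 0.
  move=> Us ps p0; apply/eqP; apply: contraLR ps => nz; rewrite -ltnNge.
  by apply: max_poly_roots => //; apply/allP => c _; apply/rootP.
have [[s0 Ss0]|infF] := classic (exists s : seq F, forall x, x \in s).
  have Us := undup_uniq s0; have Ss x : x \in undup s0 by rewrite mem_undup.
  exists (size (undup s0)); split=> [|_|p].
  - apply/eqP => s1; have := Ss 0; have := Ss 1.
    case: (undup s0) s1 => [|a []] //= _; rewrite !inE => /eqP <-.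
    by rewrite eq_sym oner_eq0.
  - exact: finite_field_expr_card.
  move=> /(_ _) ps; apply: vanish Us (ps _); rewrite size_eq0.
  by apply/eqP => s0E; have := Ss 0; rewrite s0E.
exists 0%N; split=> // p _; have [s [Us sz]] := uniq_seq_of_infinite infF (size p).
by apply: vanish Us _; rewrite sz.
Qed.

Section Independence.
Variables (F : fieldType) (q : nat).
Hypothesis poly_vanish : forall p : {poly F},
  (q != 0%N -> (size p <= q)%N) -> (forall c, p.[c] = 0) -> p = 0.

Definition reduced_exp e := (q == 0%N) || (e < q)%N.

(** Monomials with reduced exponents are independent as functions on
    [vs -> F]: in one variable this is [poly_vanish], and the variables are
    split off one at a time.  The conclusion is on sums over equal exponents, as
    the family [e] need not be injective. *)
Lemma monomial_independence (I : eqType) (r : seq I) (vs : seq nat)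
    (e : I -> nat -> nat) (c : I -> F) :
  uniq vs -> (forall i x, i \in r -> reduced_exp (e i x)) ->
  (forall d : nat -> F, \sum_(i <- r) c i * \prod_(x <- vs) d x ^+ e i x = 0) ->
  forall k : nat -> nat, \sum_(i <- r | all (fun x => e i x == k x) vs) c i = 0.
Proof.
move=> + re; elim: vs c => [|x vs IH] c /= Uvs H k.
  have := H (fun _ => 0); under eq_bigr do rewrite big_nil mulr1.
  by [].
have /andP [xvs {}Uvs] := Uvs.
have := IH (fun i => if e i x == k x then c i else 0) Uvs _ k.
rewrite -big_mkcondl; apply=> d.
(* Freeze all variables but [x]. *)
pose p : {poly F} := \sum_(i <- r) (c i * \prod_(y <- vs) d y ^+ e i y) *: 'X^(e i x).
have p0 : p = 0.
  apply: poly_vanish => [q0|t].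
    rewrite /p big_seq; apply: (leq_trans (size_sum _ _ _)).
    apply/bigmax_leqP_seq => i ir _; apply: (leq_trans (size_scale_leq _ _)).
    by rewrite size_polyXn; have := re i x ir; rewrite /reduced_exp (negPf q0).
  rewrite /p horner_sum -[RHS](H (fun y => if y == x then t else d y)).
  apply: eq_bigr => i _; rewrite hornerZ hornerXn big_cons eqxx -mulrA.
  rewrite [X in c i * X]mulrC; congr (_ * (_ * _)).
  apply: eq_big_seq => y yvs; case: eqP => // yx; by rewrite yx (negPf xvs) in yvs.
transitivity (p`_(k x)); last by rewrite p0 coef0.
rewrite coef_sum [LHS]big_mkcond /=; apply: eq_bigr => i _; rewrite coefZ coefXn eq_sym.
by case: eqP; rewrite ?mulr1 ?mulr0 ?mul0r.
Qed.

Definition word_val (d : nat -> F) (b : seq nat) : F := \prod_(i <- b) d i.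

Lemma word_val_count d b vs : uniq vs -> {subset b <= vs} ->
  word_val d b = \prod_(x <- vs) d x ^+ count_mem x b.
Proof.
move=> Uvs; rewrite /word_val; elim: b => [|i b IH] bvs.
  by rewrite big_nil big1 // => x _; rewrite expr0.
rewrite big_cons IH => [|j jb]; last by apply: bvs; rewrite inE jb orbT.
have ivs : i \in vs by rewrite bvs ?mem_head.
rewrite !(bigD1_seq i) //= eqxx exprS mulrA; congr (_ * _).
by apply: eq_bigr => x /negPf xi; rewrite eq_sym xi.
Qed.

Definition normal (b : seq nat) :=
  sorted leq b && all (fun x => reduced_exp (count_mem x b)) b.

Lemma normal_count b x : normal b -> reduced_exp (count_mem x b).
Proof.
move=> /andP [_ /allP H]; have [/H //|/count_memPn ->] := boolP (x \in b).
by rewrite /reduced_exp lt0n orbN.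
Qed.

Definition oword_val d (b : option (seq nat)) : F :=
  if b is Some b' then word_val d b' else 0.

(** A sorted word is determined by its exponents.  The option serves the words
    with a letter of degree other than 1, which vanish on the diagonal. *)
Lemma normal_independence (I : eqType) (r : seq I)
    (ob : I -> option (seq nat)) (c : I -> F) :
  (forall i b, i \in r -> ob i = Some b -> normal b) ->
  (forall d, \sum_(i <- r) c i * oword_val d (ob i) = 0) ->
  forall b, \sum_(i <- r | ob i == Some b) c i = 0.
Proof.
move=> nob H b.
have [/hasP [i0 i0r /eqP i0b]|/hasPn nb] := boolP (has (fun i => ob i == Some b) r);
  last by rewrite big_seq_cond big1 // => i /andP [/nb/negPf ->].
have Nb : normal b := nob _ _ i0r i0b.
pose nb i := odflt [::] (ob i).
pose vs := undup (flatten [seq nb i | i <- r]).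
have sub i : i \in r -> {subset nb i <= vs}.
  by move=> ir x xi; rewrite mem_undup; apply/flattenP; exists (nb i);
    rewrite ?map_f.
have Nnb i : i \in r -> normal (nb i).
  by move=> ir; rewrite /nb; case E: (ob i) => [b'|] //=; apply: nob E.
have := @monomial_independence I r vs (fun i x => count_mem x (nb i))
  (fun i => if ob i is Some _ then c i else 0) (undup_uniq _) _ _
  (fun x => count_mem x b).
move=> H0; rewrite -[RHS]H0 => {H0} [|i x ir|d]; last first.
- rewrite -[RHS](H d); apply: eq_big_seq => i ir.
  rewrite -word_val_count ?undup_uniq //; last exact: sub.
  by rewrite /nb; case: (ob i) => [b'|] /=; rewrite ?mulr0 ?mul0r.
- exact/normal_count/Nnb.
rewrite big_mkcond [RHS]big_mkcond; apply: eq_big_seq => i ir.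
case E: (ob i) => [b'|] /=; last by case: all.
have nbi : nb i = b' by rewrite /nb E.
rewrite (_ : (Some b' == Some b) = all (fun x => count_mem x (nb i) == count_mem x b) vs) //.
apply/eqP/allP => [[<-] x _|Hc]; first by rewrite nbi.
congr Some; apply: (sorted_eq leq_trans anti_leq).
- by have /andP [] := Nnb i ir; rewrite nbi.
- by have /andP [] := Nb.
apply/allP => x; rewrite mem_cat => xbb; rewrite -nbi; apply: Hc.
case/orP: xbb => xb; first by apply: (sub i ir); rewrite nbi.
by apply: (sub i0 i0r); rewrite /nb i0b.
Qed.

End Independence.

Lemma sum_by_key (I K : eqType) (V : nmodType) (r : seq I) (k : I -> K)
    (E : I -> V) :
  \sum_(i <- r) E i = \sum_(x <- undup (map k r)) \sum_(i <- r | k i == x) E i.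
Proof.
under [RHS]eq_bigr do rewrite big_mkcond.
rewrite exchange_big /=; apply: eq_big_seq => i ir.
rewrite (bigD1_seq (k i)) ?undup_uniq ?mem_undup ?map_f //= eqxx big1 ?addr0 //.
by move=> x /negPf; rewrite eq_sym => ->.
Qed.

(** * Path coefficients and normal words *)

Section NormalForm.
Variables (F : fieldType) (gT : finGroupType) (q : nat).
Local Notation X := (gT * nat)%type.
Local Notation A := (freeAlg F gT).

Definition loop_val (d : nat -> F) (x : X) : F :=
  if x.1 == 1%g then d x.2 else 0.

(** The coefficient of a word along a strict path whose steps are labelled by
    the variables in [ys]; [d] and the second components of [ys] are the values
    of the degree 1 variables at the successive vertices. *)
Fixpoint path_coef (d : nat -> F) (ys : seq (X * (nat -> F))) (w : seq X) : F :=
  if w is x :: w' then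
    loop_val d x * path_coef d ys w' +
    (if ys is (y, d') :: ys' then (x == y)%:R * path_coef d' ys' w' else 0)
  else (nilp ys)%:R.

(** The normal form of [b] times the letter [i], using x^q = x once the
    exponent of [i] reaches [q]. *)
Definition insert (b : seq nat) (i : nat) : seq nat :=
  sort leq (if (q != 0%N) && ((count_mem i b).+1 == q)
            then i :: [seq j <- b | j != i] else i :: b).

Definition push (b : seq nat) (x : X) : option (seq nat) :=
  if x.1 == 1%g then Some (insert b x.2) else None.

Definition unit_word (b : seq nat) : seq X := [seq (1%g, i) | i <- b].

Definition omono (ob : option (seq nat)) : A :=
  if ob is Some b then mono F (unit_word b) else 0.

Definition defect (k : seq nat * X) : A :=
  mono F (unit_word k.1) * var F k.2 - omono (push k.1 k.2).

(** The steps of the reduction of [w] started at the normal word [b]: each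
    records the current normal word, the next letter and what remains. *)
Fixpoint trace (b : seq nat) (w : seq X) : seq ((seq nat * X) * seq X) :=
  if w is x :: w' then
    ((b, x), w') :: (if push b x is Some b' then trace b' w' else [::])
  else [::].

Fixpoint final (b : seq nat) (w : seq X) : option (seq nat) :=
  if w is x :: w' then (if push b x is Some b' then final b' w' else None)
  else Some b.

Lemma insert_normal b i : q != 1%N -> normal q b -> normal q (insert b i).
Proof.
move=> q1 Nb; rewrite /normal sort_sorted; last exact: leq_total.
apply/allP => x _; rewrite /insert count_sort.
have Nx := normal_count x Nb; move: Nx; rewrite /reduced_exp.
have [//|q0 /=] := eqVneq q 0%N; move: q0; rewrite -lt0n => q0 Nx.
have q2 : (1 < q)%N by rewrite ltn_neqAle eq_sym q1.
case: eqP => ciq /=; rewrite ?count_filter.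
  case: (eqVneq i x) => [->|ix] /=.
    rewrite (@eq_count _ _ pred0) ?count_pred0 // => y /=; exact: andbN.
  rewrite (@eq_count _ _ (pred1 x)) // => y /=.
  by case: (eqVneq y x) => // ->; rewrite eq_sym ix.
case: (eqVneq i x) ciq Nx => [->|ix] //= ciq.
by move=> lt_q; rewrite add1n ltn_neqAle lt_q andbT; apply/eqP.
Qed.

Lemma trace_normal b w t :
  q != 1%N -> normal q b -> t \in trace b w -> normal q t.1.1.
Proof.
move=> q1; elim: w b => [|x w IH] b Nb //=; rewrite inE => /predU1P [-> //|].
by rewrite /push; case: ifP => // _; apply: IH; exact: insert_normal.
Qed.

Lemma final_normal b w b' :
  q != 1%N -> normal q b -> final b w = Some b' -> normal q b'.
Proof.
move=> q1; elim: w b => [|x w IH] b Nb /=; first by case=> <-.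
by rewrite /push; case: ifP => // _; apply: IH; exact: insert_normal.
Qed.

Lemma trace_size b w t : t \in trace b w -> (size t.2 < size w)%N.
Proof.
elim: w b => [|x w IH] b //=; rewrite inE => /predU1P [-> //|].
by case: push => // b' /IH; exact: leqW.
Qed.

(** The sum telescopes: each step replaces the current normal word times the
    next letter by its normal form, up to a defect. *)
Lemma trace_telescope b w : mono F (unit_word b) * mono F w =
  omono (final b w) + \sum_(t <- trace b w) defect t.1 * mono F t.2.
Proof.
elim: w b => [|x w IH] b /=; first by rewrite mono_nil mulr1 big_nil addr0.
have Hpush : omono (push b x) * mono F w =
    omono (if push b x is Some b' then final b' w else None) +
    \sum_(t <- if push b x is Some b' then trace b' w else [::])
      defect t.1 * mono F t.2.
  by case: push => [b'|]; rewrite ?[LHS]IH //= mul0r big_nil addr0.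
rewrite big_cons addrCA -Hpush mono_cons mulrA /defect -mulrDl.
by congr (_ * _); rewrite subrK.
Qed.

Hypothesis expr_q : q != 0%N -> forall c : F, c ^+ q = c.

Lemma insert_val d b i : word_val d (insert b i) = d i * word_val d b :> F.
Proof.
rewrite /insert /word_val (perm_big _ (permEl (perm_sort _ _))) /=.
case: ifP => [/andP [q0 /eqP ciq]|_]; rewrite big_cons //.
rewrite big_filter [in RHS](bigID (pred1 i)) /= mulrA; congr (_ * _).
rewrite (eq_bigr (fun=> d i)) => [|j /eqP -> //].
by rewrite big_const_seq iter_mulr mulr1 -exprS ciq expr_q.
Qed.

Lemma push_val d b x : oword_val d (push b x) = loop_val d x * word_val d b.
Proof.
by rewrite /push /loop_val; case: ifP => _ /=; rewrite ?insert_val ?mul0r.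
Qed.

Lemma path_coef_nil d b w :
  path_coef d [::] w * word_val d b = oword_val d (final b w).
Proof.
elim: w b => [|x w IH] b /=; first by rewrite mul1r.
rewrite addr0 mulrAC -push_val.
by case: push => [b'|] /=; rewrite ?mul0r // mulrC IH.
Qed.

(** Split a path coefficient according to the position of its first strict
    step: the letters before it contribute the value of their normal form. *)
Lemma path_coef_cons d y d' ys b w :
  path_coef d ((y, d') :: ys) w * word_val d b =
  \sum_(t <- trace b w) ((t.1.2 == y)%:R * path_coef d' ys t.2) * word_val d t.1.1.
Proof.
elim: w b => [|x w IH] b; first by rewrite /= mul0r big_nil.
rewrite [path_coef _ _ _]/= [trace _ _]/= mulrDl mulrAC -push_val big_cons /=.
rewrite addrC; congr (_ + _).
by case: push => [b'|] /=; rewrite ?mul0r ?big_nil // mulrC IH.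
Qed.

Definition lin_eval (s : seq (F * seq X)) : A := \sum_(t <- s) t.1 *: mono F t.2.

Definition lin_coef d ys (s : seq (F * seq X)) : F :=
  \sum_(t <- s) t.1 * path_coef d ys t.2.

Hypotheses (q1 : q != 1%N) (poly_vanish : forall p : {poly F},
  (q != 0%N -> (size p <= q)%N) -> (forall c, p.[c] = 0) -> p = 0).

Variables (L : seq gT -> Prop) (J : A -> Prop).
Hypotheses (J0 : J 0) (JD : forall f h, J f -> J h -> J (f + h))
  (JM : forall f h, J f -> J (f * h)).
Hypothesis J_defects : forall ks : seq (seq nat * X),
  ~ L [seq k.2.1 | k <- ks] -> J (\prod_(k <- ks) defect k).

(** The hypothesis on [s] concerns the paths that extend the degree word of
    the defects in [ks] already split off.  If that word is outside [L] nothing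
    is left to prove.  Otherwise the path without strict steps shows that the
    normal part of [s] vanishes, and the remaining terms are treated by
    induction on the length, grouped by their first defect: by independence of
    normal words, each cofactor satisfies the hypothesis for the extended
    list. *)
Lemma path_coef_kernel n (s : seq (F * seq X)) (ks : seq (seq nat * X)) :
  (forall t, t \in s -> (size t.2 < n)%N) ->
  (forall d ys, L ([seq k.2.1 | k <- ks] ++ [seq y.1.1 | y <- ys]) ->
    lin_coef d ys s = 0) ->
  J (\prod_(k <- ks) defect k * lin_eval s).
Proof.
elim: n s ks => [|n IH] s ks sn Hs.
  case: s sn {Hs} => [_|t s /(_ t)]; last by rewrite mem_head => /(_ isT).
  by rewrite /lin_eval big_nil mulr0.
have [Lks|nL] := classic (L [seq k.2.1 | k <- ks]); last exact/JM/J_defects.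
pose T := [seq (t.1, u) | t <- s, u <- trace [::] t.2].
have -> : lin_eval s = \sum_(t <- s) t.1 *: omono (final [::] t.2) +
    \sum_(u <- T) u.1 *: (defect u.2.1 * mono F u.2.2).
  rewrite big_allpairs_dep -big_split; apply: eq_bigr => t _ /=.
  rewrite -scaler_sumr -scalerDr -trace_telescope.
  by rewrite /= mono_nil mul1r.
have -> : \sum_(t <- s) t.1 *: omono (final [::] t.2) = 0.
  rewrite (sum_by_key _ (fun t => final [::] t.2)) big1 // => -[b|] _; last first.
    by rewrite big1 // => t /eqP ->; rewrite scaler0.
  rewrite (eq_bigr (fun t => t.1 *: omono (Some b))) => [|t /eqP -> //].
  rewrite -scaler_suml (@normal_independence _ q _ _ _ (fun t => final [::] t.2)).
  - by rewrite scale0r.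
  - exact: poly_vanish.
  - by move=> t b' _; exact: final_normal.
  move=> d; rewrite -[RHS](Hs d [::]) ?cats0 //.
  apply: eq_bigr => t _; rewrite -path_coef_nil.
  by rewrite /word_val big_nil mulr1.
(* Collect the cofactors of each defect [k] into the list [sk]. *)
rewrite add0r (sum_by_key _ (fun u => u.2.1)) mulr_sumr.
elim: (undup _) => [|k r IHr]; first by rewrite big_nil.
rewrite big_cons; apply: JD IHr.
pose sk := [seq (u.1, u.2.2) | u <- T & u.2.1 == k].
have -> : \sum_(u <- T | u.2.1 == k) u.1 *: (defect u.2.1 * mono F u.2.2) =
    defect k * lin_eval sk.
  rewrite /lin_eval big_map big_filter mulr_sumr.
  by apply: eq_bigr => u /eqP ->; rewrite freeAlg_scaleAr.
rewrite mulrA -big_rcons; apply: IH => [t|d ys].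
  move=> /mapP [u]; rewrite mem_filter => /andP [_ /allpairsPdep [t' [v [t's vt' ->]]]] -> /=.
  by rewrite -ltnS; apply: leq_trans (sn _ t's); rewrite ltnS; exact: trace_size vt'.
rewrite map_rcons cat_rcons => HL.
rewrite /lin_coef big_map big_filter.
have := @normal_independence _ q poly_vanish _ T (fun u => Some u.2.1.1)
  (fun u => u.1 * ((u.2.1.2 == k.2)%:R * path_coef d ys u.2.2)) _ _ k.1.
move=> H; rewrite -[RHS]H => {H} [|u b /allpairsPdep [t [v [ts vt ->]]] [<-]|d0].
- rewrite [LHS]big_mkcond [RHS]big_mkcond; apply: eq_bigr => u _.
  case: u => c [[b x] w]; clear sk HL; case: k => bk xk /=.
  rewrite xpair_eqE (inj_eq Some_inj).
  by case: eqP => //= _; case: eqP => /=; rewrite ?mul1r ?mul0r ?mulr0.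
- exact: trace_normal vt.
rewrite -[RHS](Hs d0 ((k.2, d) :: ys) HL) big_allpairs_dep.
apply: eq_bigr => t _ /=.
have w1 : word_val d0 [::] = 1 by rewrite /word_val big_nil.
rewrite -[X in _ = _ * X]mulr1 -[X in _ = _ * (_ * X)]w1.
rewrite path_coef_cons mulr_sumr; apply: eq_bigr => u _ /=.
by rewrite !mulrA.
Qed.

End NormalForm.

(** * Matrix entries *)

Section Entries.
Variable F : fieldType.

Definition coef (a : UT F) (i j : nat) : F :=
  if insub (i, j) is Some p then a@_p else 0.

(** UT1 acts as upper triangular infinite matrices, the scalars as scalar
    matrices.  As elements of UT have finite support, this is faithful. *)
Definition entry (u : UT1 F) (i j : nat) : F := u.1 * (i == j)%:R + coef u.2 i j.

Lemma coefZ c a i j : coef (c *: a) i j = c * coef a i j.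
Proof. by rewrite /coef; case: insub => [p|]; rewrite ?mcoeffZ ?mulr0. Qed.

Lemma coefD a b i j : coef (a + b) i j = coef a i j + coef b i j.
Proof. by rewrite /coef; case: insub => [p|]; rewrite ?mcoeffD ?addr0. Qed.

Lemma coef0 i j : coef 0 i j = 0.
Proof. by rewrite /coef; case: insub => [p|]; rewrite ?mcoeff0. Qed.

Lemma coef_UTidx a (p : UTidx) : coef a (UTrow p) (UTcol p) = a@_p.
Proof.
rewrite /coef; case: insubP => [p' _ pE|]; last by rewrite (valP p).
by congr (_@__); apply: val_inj; rewrite pE -surjective_pairing.
Qed.

Lemma coefU p i j : coef << p >> i j = (UTpair p == (i, j))%:R.
Proof.
rewrite /coef; case: insubP => [p' _ <-|]; first by rewrite mcoeffU -val_eqE.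
by case: eqP => // <-; rewrite (valP p).
Qed.

Lemma coef_sum (I : Type) (r : seq I) (a : I -> UT F) i j :
  coef (\sum_(t <- r) a t) i j = \sum_(t <- r) coef (a t) i j.
Proof.
exact: (big_morph (fun b => coef b i j) (fun _ _ => coefD _ _ _ _) (coef0 _ _)).
Qed.

Lemma coef_mul_basis (p p' : UTidx) i j : coef (UTmul << p >> << p' >>) i j =
  \sum_(i <= k < j.+1) coef << p >> i k * coef << p' >> k j.
Proof.
case: p p' => [[i0 k0] /= ik] [[k1 j0] /= kj].
under eq_bigr do rewrite !coefU /= !xpair_eqE.
have [ek|nk] := eqVneq k0 k1; last first.
  rewrite (UTmul_e_neq _ _ _ nk) coef0 big1 // => k _.
  case: (k0 =P k) => [<-|]; rewrite ?andbF ?mul0r //.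
  by rewrite [k1 == _]eq_sym (negPf nk) mulr0.
subst k1; rewrite (UTmul_e_eq _ _ _ (leq_trans ik kj)) coefU xpair_eqE /=.
have [ei|_] := eqVneq i0 i; last by rewrite big1 // => k _; rewrite mul0r.
have [ej|_] := eqVneq j0 j; last by rewrite big1 // => k _; rewrite andbF mulr0.
subst i0 j0; rewrite (bigD1_seq k0) ?iota_uniq ?mem_index_iota ?ik //= eqxx mul1r.
by rewrite big1 ?addr0 // => k /negPf; rewrite eq_sym => ->; rewrite mul0r.
Qed.

Lemma coef_mul a b i j :
  coef (UTmul a b) i j = \sum_(i <= k < j.+1) coef a i k * coef b k j.
Proof.
rewrite (UTdecomp a) UTmul_suml coef_sum.
under [RHS]eq_bigr do rewrite coef_sum mulr_suml.
rewrite exchange_big /=; apply: eq_bigr => p _.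
rewrite UTmulZl coefZ; under [RHS]eq_bigr do rewrite coefZ -mulrA.
rewrite -mulr_sumr; congr (_ * _).
rewrite (UTdecomp b) UTmul_sumr coef_sum.
under [RHS]eq_bigr do rewrite coef_sum mulr_sumr.
rewrite exchange_big /=; apply: eq_bigr => p' _.
rewrite UTmulZr coefZ; under [RHS]eq_bigr do rewrite coefZ mulrCA.
by rewrite -mulr_sumr coef_mul_basis.
Qed.

Lemma coef_lower a i j : (j < i)%N -> coef a i j = 0.
Proof. by move=> ji; rewrite /coef insubF //= leqNgt ji. Qed.

Lemma entryD u v i j : entry (u + v) i j = entry u i j + entry v i j.
Proof. by rewrite /entry /= coefD mulrDl addrACA. Qed.

Lemma entryZ c u i j : entry (c *: u) i j = c * entry u i j.
Proof. by rewrite /entry /= coefZ mulrDr mulrA. Qed.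

Lemma entry0 i j : entry 0 i j = 0.
Proof. by rewrite -(scale0r 0) entryZ mul0r. Qed.

Lemma entryN u i j : entry (- u) i j = - entry u i j.
Proof. by rewrite -scaleN1r entryZ mulN1r. Qed.

Lemma entry_sum (I : Type) (r : seq I) (u : I -> UT1 F) i j :
  entry (\sum_(t <- r) u t) i j = \sum_(t <- r) entry (u t) i j.
Proof.
exact: (big_morph (fun v => entry v i j) (fun _ _ => entryD _ _ _ _) (entry0 _ _)).
Qed.

Lemma entry1 i j : entry 1 i j = (i == j)%:R.
Proof. by rewrite /entry /= coef0 addr0 mul1r. Qed.

Lemma entry_incl a i j : entry (UTincl a) i j = coef a i j.
Proof. by rewrite /entry /= mul0r add0r. Qed.

Lemma entry_lower u i j : (j < i)%N -> entry u i j = 0.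
Proof.
by move=> ji; rewrite /entry coef_lower // addr0 gtn_eqF // mulr0.
Qed.

Lemma entryM u v i j :
  entry (u * v) i j = \sum_(i <= k < j.+1) entry u i k * entry v k j.
Proof.
have [ij|ji] := leqP i j; last by rewrite entry_lower // big_geq.
rewrite {1}/entry /= !coefD !coefZ coef_mul.
under [RHS]eq_bigr do rewrite /entry mulrDl !mulrDr.
rewrite !big_split /=.
have ii : i \in index_iota i j.+1 by rewrite mem_index_iota leqnn.
have jj : j \in index_iota i j.+1 by rewrite mem_index_iota ij /=.
have E1 c (E : nat -> F) : \sum_(i <= k < j.+1) c * (i == k)%:R * E k = c * E i.
  rewrite (bigD1_seq i) ?iota_uniq //= eqxx mulr1 big1 ?addr0 // => k.
  by rewrite eq_sym => /negPf ->; rewrite mulr0 mul0r.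
have E2 c (E : nat -> F) : \sum_(i <= k < j.+1) E k * (c * (k == j)%:R) = c * E j.
  rewrite (bigD1_seq j) ?iota_uniq //= eqxx mulr1 big1 ?addr0 => [|k /negPf ->].
    by rewrite mulrC.
  by rewrite !mulr0.
rewrite (E1 u.1 (fun k => v.1 * (k == j)%:R)) (E1 u.1 (fun k => coef v.2 k j)).
by rewrite (E2 v.1 (fun k => coef u.2 i k)) mulrA !addrA.
Qed.

Lemma entry_inj u : (forall i j, entry u i j = 0) -> u = 0.
Proof.
move=> H.
have u1 : u.1 = 0.
  (* A diagonal position beyond the support of [u.2]. *)
  pose n := (\max_(p <- msupp u.2) UTrow p).+1.
  have := H n n; rewrite /entry eqxx mulr1 /coef; case: insubP => [p _ pn|_].
    rewrite mcoeff_outdom ?addr0 //; apply/negP => pu.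
    have : (UTrow p < n)%N by rewrite ltnS; exact: leq_bigmax_seq.
    by rewrite /UTrow (pn : UTpair p = _) /= ltnn.
  by rewrite addr0.
apply: injective_projections => //=; apply/malgP => p; rewrite mcoeff0.
have := H (UTrow p) (UTcol p); by rewrite /entry u1 mul0r add0r coef_UTidx.
Qed.

Lemma entryM_neq0 u v i j : entry (u * v) i j != 0 ->
  exists k, entry u i k != 0 /\ entry v k j != 0.
Proof.
rewrite entryM => nz; apply: NNPP => H; move/eqP: nz; apply.
apply: big1 => k _; apply/eqP; apply: contraT; rewrite mulf_eq0 negb_or.
by move=> /andP [? ?]; case: H; exists k.
Qed.

Definition cut (n : nat) (m : nat -> nat -> F) : UT F :=
  \sum_(i <- iota 0 n.+1) \sum_(j <- iota 0 n.+1)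
    (if insub (i, j) is Some p then m i j *: (<< p >> : UT F) else 0).

Lemma coef_cut n m i j :
  coef (cut n m) i j = if (i <= j <= n)%N then m i j else 0.
Proof.
rewrite /cut coef_sum.
under eq_bigr do rewrite coef_sum.
have E i' j' : coef (if insub (i', j') is Some p then m i' j' *: (<< p >> : UT F) else 0) i j
    = if (i' == i) && (j' == j) && (i <= j)%N then m i j else 0.
  case: insubP => [p ij' pE|nij]; last first.
    rewrite coef0.
    by case: (i' =P i) nij => [->|] //; case: (j' =P j) => [->|] //= /negPf ->.
  rewrite coefZ coefU (pE : UTpair p = _) xpair_eqE.
  case: (i' =P i) ij' => [->|] /=; rewrite ?mulr0 //.
  by case: (j' =P j) => [->|] /= ; rewrite ?mulr0 // => ->; rewrite mulr1.
under eq_bigr do under eq_bigr do rewrite E.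
have [ij|ji] := leqP i j; last first.
  by rewrite big1 // => i' _; rewrite big1 // => j' _; rewrite andbF.
have [jn|nj] := leqP j n; last first.
  rewrite big1_seq // => i' _; rewrite big1_seq // => j' /andP [_].
  by case: (j' =P j) => [->|_]; rewrite ?andbF // mem_iota add0n ltnS [(j <= n)%N]leqNgt nj.
have i_n := leq_trans ij jn.
rewrite (bigD1_seq i) ?iota_uniq ?mem_iota ?add0n ?ltnS //.
rewrite (bigD1_seq j) ?iota_uniq ?mem_iota ?add0n ?ltnS // !eqxx.
rewrite !big1 /= ?addr0 // => [i' /negPf ->|j' /negPf -> //]; by rewrite big1.
Qed.

End Entries.

(** * Graded evaluations *)

Section Evaluation.
Variables (F : fieldType) (gT : finGroupType) (eps : nat -> gT).
Local Notation X := (gT * nat)%type.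
Local Notation A := (freeAlg F gT).

Definition pt (n : nat) : gT := (\prod_(0 <= k < n) eps k)%g.

Lemma UTdeg_pt p : (pt (UTrow p) * UTdeg eps p = pt (UTcol p))%g.
Proof. by rewrite /pt /UTdeg -big_cat_nat //; exact: (valP p). Qed.

Definition graded (g : gT) (u : UT1 F) : Prop :=
  forall i j, entry u i j != 0 -> (pt i * g = pt j)%g.

Lemma homogeneous_incl g a :
  reflect (graded g (UTincl a)) (homogeneous (UTdeg eps) g a).
Proof.
apply: (iffP allP) => H.
  move=> i j; rewrite entry_incl /coef; case: insubP => [p _ pE|]; last by rewrite eqxx.
  rewrite mcoeff_neq0 => /H /eqP <-.
  by have := UTdeg_pt p; rewrite /UTrow /UTcol (pE : UTpair p = _).
move=> p pa; apply/eqP/(mulgI (pt (UTrow p))); rewrite UTdeg_pt (H _ (UTcol p)) //.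
by rewrite entry_incl coef_UTidx mcoeff_neq0.
Qed.

Lemma graded1 : graded 1%g 1.
Proof.
move=> i j; rewrite entry1 mulg1; case: (i =P j) => [-> //|_].
by rewrite eqxx.
Qed.

Lemma gradedM g h u v : graded g u -> graded h v -> graded (g * h)%g (u * v).
Proof.
move=> Hu Hv i j /entryM_neq0 [k [uk vk]].
by rewrite mulgA (Hu _ _ uk) (Hv _ _ vk).
Qed.

Lemma gradedD g u v : graded g u -> graded g v -> graded g (u + v).
Proof.
move=> Hu Hv i j; rewrite entryD; have [->|/Hu //] := eqVneq (entry u i j) 0.
by rewrite add0r; exact: Hv.
Qed.

Lemma gradedZ g c u : graded g u -> graded g (c *: u).
Proof.
move=> Hu i j; rewrite entryZ mulf_eq0 negb_or => /andP [_]; exact: Hu.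
Qed.

Lemma graded_subst (u : X -> UT1 F) g (f : A) :
  (forall x, graded x.1 (u x)) -> homogeneous (@wdeg gT) g f ->
  graded g (subst u f).
Proof.
move=> Hu /allP Hf; rewrite substE big_seq.
elim/big_ind: _ => [i j|v w|w /Hf /eqP <-]; first by rewrite entry0 eqxx.
  exact: gradedD.
apply: gradedZ; rewrite /wdeg; elim: (fmonom_val w) => [|x v IH].
  by rewrite !big_nil; exact: graded1.
by rewrite !big_cons; apply: gradedM.
Qed.

Lemma IdG_entry (f : A) : IdG eps f <-> forall (a : X -> UT F),
  (forall x, graded x.1 (UTincl (a x))) -> 
  forall i j, entry (UTeval a f) i j = 0.
Proof.
split=> H a Ha; last first.
  by apply: entry_inj; apply: H => -[g i]; apply/homogeneous_incl; exact: Ha.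
move=> i j; rewrite H ?entry0 // => g k; apply/homogeneous_incl.
exact: (Ha (g, k)).
Qed.

(** An entry in column [j] of a product depends only on rows and columns up
    to [j]. *)
Lemma entry_prod_cut (u : X -> UT1 F) n w i j : (j <= n)%N ->
  entry (\prod_(x <- w) UTincl (cut n (entry (u x)))) i j =
  entry (\prod_(x <- w) u x) i j.
Proof.
elim: w i j => [|x w IH] i j jn; first by rewrite !big_nil.
rewrite !big_cons !entryM; apply: eq_big_nat => k /andP [ik]; rewrite ltnS => kj.
by rewrite IH // entry_incl coef_cut ik (leq_trans kj jn).
Qed.

(** An identity also vanishes on graded elements of UT1 with a scalar part:
    entrywise, these can be cut down to elements of UT. *)
Lemma IdG_subst (u : X -> UT1 F) (f : A) :
  IdG eps f -> (forall x, graded x.1 (u x)) -> subst u f = 0.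
Proof.
move=> /IdG_entry Hf Hu; apply: entry_inj => i j.
rewrite -[RHS](Hf (fun x => cut j (entry (u x))) _ i j) => [|x k l].
  rewrite -[UTeval _ _]/(subst _ _) !substE !entry_sum; apply: eq_bigr => w _.
  by rewrite !entryZ entry_prod_cut.
by rewrite entry_incl coef_cut; case: ifP => _; rewrite ?eqxx //; exact: Hu.
Qed.

Let evalAr (c : F) (s t : UT1 F) : c *: (s * t) = s * (c *: t) := scalerAr c s t.

(** Closure under endomorphisms needs [IdG_subst], as a degree-preserving
    endomorphism may add constants to the variables of degree 1. *)
Lemma IdG_graded_T_ideal : graded_T_ideal (@IdG F gT eps).
Proof.
pose ev (a : X -> UT F) := subst_lr (fun x => UTincl (a x)) evalAr.
have E0 a : UTeval a 0 = 0 := linear0 (ev a).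
have ED a f h : UTeval a (f + h) = UTeval a f + UTeval a h :=
  linearD (ev a) f h.
have EM a f h : UTeval a (f * h) = UTeval a f * UTeval a h :=
  rmorphM (ev a) f h.
split=> [a Ha|f h If Ih a Ha|f h If a Ha|f h If a Ha|phi dphi f If a Ha].
- exact: E0.
- by rewrite ED If // Ih // addr0.
- by rewrite EM If // mulr0.
- by rewrite EM If // mul0r.
have -> : UTeval a (phi f) =
    (ev a \o phi : {lrmorphism A -> UT1 F}) f by [].
rewrite subst_lrmorph; apply: (IdG_subst If) => x.
apply: graded_subst => [[g i]|]; first by apply/homogeneous_incl.
by apply: dphi; case: x => g i; exact: hom_var.
Qed.

(** * Reading off path coefficients *)

Definition pts (a : gT) (l : seq gT) : seq gT := a :: scanl mulg a l.

Lemma map_pts g a l : [seq (g * b)%g | b <- pts a l] = pts (g * a)%g l.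
Proof. by rewrite /pts /=; congr (_ :: _); elim: l a => [|b l IH] a //=; rewrite IH mulgA. Qed.

Lemma embeds_translate (p : nat -> gT) n g w :
  embeds p n w -> embeds (fun m => g * p m)%g n [seq (g * b)%g | b <- w].
Proof.
elim: w n => [|a w IH] n //= [m [nm pm mw]].
by exists m; rewrite pm; split=> //; exact: IH.
Qed.

Fixpoint mat_prod (m : X -> nat -> nat -> F) (w : seq X) (i j : nat) : F :=
  if w is x :: w' then \sum_(i <= k < j.+1) m x i k * mat_prod m w' k j
  else (i == j)%:R.

(** Put the prescribed values on the diagonal at the vertices of the path, and
    put 1 on the edge of each strict step for the variable labelling it.  Then
    the only paths from the first to the last vertex are those counted by
    [path_coef]. *)
Lemma path_matrix (g : gT) ys n a d :
  embeds (fun k => g * pt k)%g n (pts a [seq y.1.1 | y <- ys]) ->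
  exists i j (m : X -> nat -> nat -> F), [/\ (n <= i <= j)%N, (g * pt i = a)%g,
    forall x k l, m x k l != 0 -> (i <= k)%N /\ (pt k * x.1 = pt l)%g &
    forall w, mat_prod m w i j = path_coef d ys w].
Proof.
elim: ys n a d => [|[y d'] ys IH] n a d [i [ni pi]] /=.
  move=> _; exists i, i, (fun x k l => if (k == i) && (l == i) then loop_val d x else 0).
  split=> [||x k l|w] //; first by rewrite ni leqnn.
    case: ifP => [/andP [/eqP -> /eqP ->]|]; last by rewrite eqxx.
    by rewrite /loop_val; case: (x.1 =P 1%g) => [->|]; rewrite ?eqxx ?mulg1.
  elim: w => [|x w IHw] /=; first by rewrite eqxx.
  by rewrite big_nat1 !eqxx IHw addr0.
move=> /IH - /(_ d') [i1 [j [m [/andP [ii1 i1j] pi1 Hm Em]]]].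
pose m' x k l := if k == i then (if l == i then loop_val d x
  else if l == i1 then (x == y)%:R else 0) else m x k l.
have Em' w k : (i < k)%N -> mat_prod m' w k j = mat_prod m w k j.
  elim: w k => [|x w IHw] k ik //=; apply: eq_big_nat => l /andP [kl _].
  by rewrite IHw ?(leq_trans ik) // /m' gtn_eqF.
exists i, j, m'; split=> [||x k l|w] //.
- by rewrite ni (leq_trans (ltnW ii1)).
- rewrite /m'; case: (k =P i) => [->|_]; last first.
    by move=> /Hm [i1k ?]; split=> //; apply: leq_trans (ltnW ii1) i1k.
  case: (l =P i) => [->|_].
    by rewrite /loop_val; case: (x.1 =P 1%g) => [->|]; rewrite ?eqxx ?mulg1.
  case: (l =P i1) => [->|]; last by rewrite eqxx.
  case: (x =P y) => [->|]; last by rewrite eqxx.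
  by split=> //; apply: (mulgI g); rewrite mulgA pi pi1.
elim: w => [|x w IHw] /=; first by rewrite ltn_eqF // (leq_trans ii1).
rewrite (bigD1_seq i) ?iota_uniq ?mem_index_iota ?leqnn ?ltnS ?(leq_trans (ltnW ii1)) //=.
rewrite [X in _ + X]big_mkcond (bigD1_seq i1) ?iota_uniq //=; last first.
  by rewrite mem_index_iota ltnW.
rewrite gtn_eqF //= big1 ?addr0 => [|k /negPf ki1]; last first.
  by case: ifP => // /negPf ki; rewrite /m' eqxx ki ki1 mul0r.
by rewrite {1 3}/m' !eqxx gtn_eqF // IHw Em' // Em.
Qed.

Lemma IdG_path_coef (f : A) g d ys : IdG eps f ->
  embeds (fun k => g * pt k)%g 0 (pts 1%g [seq y.1.1 | y <- ys]) ->
  \sum_(w <- msupp f) f@_w * path_coef d ys (fmonom_val w) = 0.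
Proof.
move=> /IdG_entry If /(path_matrix d) [i [j [m [/andP [_ ij] _ Hm Em]]]].
rewrite -[RHS](If (fun x => cut j (m x)) _ i j) => [|x k l].
  rewrite -[UTeval _ _]/(subst _ _) substE entry_sum; apply: eq_bigr => w _.
  rewrite entryZ -Em; congr (_ * _).
  elim: (fmonom_val w) (i) => [|x v IH] k /=; first by rewrite big_nil entry1.
  rewrite big_cons entryM; apply: eq_big_nat => l /andP [kl]; rewrite ltnS => lj.
  by rewrite -IH entry_incl coef_cut kl lj.
by rewrite entry_incl coef_cut; case: ifP => _; rewrite ?eqxx // => /Hm [].
Qed.

(** A nonzero entry comes from a path that increases strictly, as the diagonals
    vanish; its vertices give the embedding. *)
Lemma strict_product_embeds (us : seq (gT * UT1 F)) i j :
  (forall u, u \in us -> graded u.1 u.2 /\ forall k, entry u.2 k k = 0) ->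
  entry (\prod_(u <- us) u.2) i j != 0 ->
  embeds pt i (pts (pt i) [seq u.1 | u <- us]).
Proof.
elim: us i => [|u us IH] i Hus; first by exists i.
rewrite big_cons => /entryM_neq0 [k [uk vk]]; exists i; split=> //.
have [Gu Du] := Hus u (mem_head _ _).
have ik : (i < k)%N.
  case: (ltngtP i k) uk => // [ki|->]; last by rewrite Du eqxx.
  by rewrite entry_lower ?eqxx.
have Hus' v : v \in us -> graded v.1 v.2 /\ forall k, entry v.2 k k = 0.
  by move=> vus; apply: Hus; rewrite inE vus orbT.
have := IH k Hus' vk; rewrite -(Gu _ _ uk) /=; exact: (@embeds_leq _ _ _ _ (_ :: _) ik).
Qed.

End Evaluation.

(** * Cutting a product at a subsequence of its partial degrees *)

Section Blocks.
Variables (gT : finGroupType) (K : Type) (deg : K -> gT).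

(** The degrees of the blocks obtained by cutting a product at the partial
    degrees [a :: s]. *)
Definition quotients (a : gT) (s : seq gT) : seq gT :=
  pairmap (fun x y => x^-1 * y)%g a s.

Lemma pts_quotients a s :
  pts 1%g (quotients a s) = [seq (a^-1 * b)%g | b <- a :: s].
Proof.
rewrite /pts /= mulVg; congr (_ :: _).
suff H h b : scanl mulg (h * b)%g (quotients b s) = [seq (h * c)%g | c <- s].
  by rewrite -{1}(mulVg a) H.
by elim: s b => [|c s IH] b //=; rewrite -mulgA mulKVg IH.
Qed.

Definition deg_prod (ks : seq K) : gT := (\prod_(k <- ks) deg k)%g.

Lemma subseq_pts_split a s h ks : subseq (a :: s) (pts h (map deg ks)) ->
  exists pre rest, [/\ ks = pre ++ rest, (h * deg_prod pre)%g = a &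
    subseq s (scanl mulg a (map deg rest))].
Proof.
rewrite /deg_prod; elim: ks h => [|k ks IH] h /=; case: (a =P h) => [->|_] //.
- by exists [::], [::]; rewrite big_nil mulg1.
- by exists [::], (k :: ks); rewrite big_nil mulg1.
move=> /IH [pre [rest [-> <- H]]]; exists (k :: pre), rest.
by rewrite big_cons mulgA.
Qed.

Lemma subseq_pts_blocks s a ks : subseq s (scanl mulg a (map deg ks)) ->
  exists (bls : seq (K * seq K)) post,
    ks = flatten [seq b.1 :: b.2 | b <- bls] ++ post /\
    [seq deg_prod (b.1 :: b.2) | b <- bls] = quotients a s.
Proof.
elim: s a ks => [|b s IH] a ks; first by exists [::], ks.
case: ks => [|k ks] //= /subseq_pts_split [pre [rest [-> Hb /IH]]].
move=> [bls [post [-> Hbls]]]; exists ((k, pre) :: bls), post.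
rewrite /= catA /deg_prod big_cons; split=> //; rewrite -Hbls; congr (_ :: _).
by rewrite -Hb /deg_prod -mulgA mulKg.
Qed.

End Blocks.

(** * The factors of the generating identities *)

Section Slots.
Variables (F : fieldType) (gT : finGroupType) (q : nat).
Local Notation X := (gT * nat)%type.
Local Notation A := (freeAlg F gT).
Local Notation hom g f := (homogeneous (@wdeg gT) g (f : A)).

(** The shapes of factors with zero diagonal.  [Gen g] is an arbitrary element
    of degree [g <> 1]; the others have degree 1. *)
Definition slot : finType := (gT + (gT + bool))%type.
Notation Gen g := (inl g) (only parsing).
Notation Pair h := (inr (inl h)) (only parsing).
Notation Comm := (inr (inr true)) (only parsing).
Notation Power := (inr (inr false)) (only parsing).

Definition slot_args (k : slot) : gT * gT * gT :=
  match k with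
  | Gen g => (g, 1, 1)
  | Pair h => (h, h^-1, 1)
  | _ => (1, 1, 1)
  end%g.

Definition slot_eval (S : nzRingType) (k : slot) (a b c : S) : S :=
  match k with
  | Gen _ => a
  | Pair _ => a * b
  | Comm => (a * b - b * a) * c
  | Power => (a ^+ q - a) * c
  end.

Definition admissible (k : slot) (g : gT) : bool :=
  match k with
  | Gen h => (h == g) && (g != 1%g)
  | Pair h => (g == 1%g) && (h != 1%g)
  | Comm => g == 1%g
  | Power => (g == 1%g) && (q != 0%N)
  end.

Lemma slot_eval_morph (S S' : nzRingType) (phi : {rmorphism S -> S'}) k a b c :
  phi (slot_eval k a b c) = slot_eval k (phi a) (phi b) (phi c).
Proof.
by case: k => [g|[h|[]]] //=; rewrite !(rmorphM, rmorphB, rmorphXn).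
Qed.

(** The factor number [n] uses the variables of indices [3n], [3n+1], [3n+2],
    so that distinct factors can be specialized independently. *)
Fixpoint template (n : nat) (sl : seq slot) : A :=
  if sl is k :: sl' then
    slot_eval k (var F ((slot_args k).1.1, (3 * n)%N))
      (var F ((slot_args k).1.2, (3 * n).+1))
      (var F ((slot_args k).2, (3 * n).+2)) * template n.+1 sl'
  else 1.

Definition instance (g : gT) (f : A) : Prop :=
  exists k a b c, [/\ admissible k g, hom (slot_args k).1.1 a,
    hom (slot_args k).1.2 b, hom (slot_args k).2 c & f = slot_eval k a b c].

Definition instance_sum (g : gT) (f : A) : Prop :=
  exists2 r : seq A, forall x, x \in r -> instance g x & f = \sum_(x <- r) x.

Lemma instance_mulr f h : instance 1%g f -> hom 1%g h -> instance 1%g (f * h).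
Proof.
move=> [k [a [b [c [Hk Ha Hb Hc ->]]]]] Hh; exists k.
case: k Hk Ha Hb Hc => [g /=|[g|[]]] Hk Ha Hb Hc.
- by case/andP: Hk => _; rewrite eqxx.
- exists a, (b * h), c; split; [exact: Hk|exact: Ha|exact: homMr|exact: Hc|].
  by rewrite [RHS]mulrA.
- exists a, b, (c * h); split; [exact: Hk|exact: Ha|exact: Hb|exact: homMr|].
  by rewrite [RHS]mulrA.
- exists a, b, (c * h); split; [exact: Hk|exact: Ha|exact: Hb|exact: homMr|].
  by rewrite [RHS]mulrA.
Qed.

Lemma instance_sum0 g : instance_sum g 0.
Proof. by exists [::]; rewrite ?big_nil. Qed.

Lemma instance_sumI g f : instance g f -> instance_sum g f.
Proof.
by exists [:: f]; rewrite ?big_seq1 // => x; rewrite inE => /eqP ->.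
Qed.

Lemma instance_sumD g f h :
  instance_sum g f -> instance_sum g h -> instance_sum g (f + h).
Proof.
move=> [r Hr ->] [s Hs ->]; exists (r ++ s); last by rewrite big_cat.
by move=> x; rewrite mem_cat => /orP [/Hr|/Hs].
Qed.

Lemma instance_sum_mulr f h :
  instance_sum 1%g f -> hom 1%g h -> instance_sum 1%g (f * h).
Proof.
move=> [r Hr ->] Hh; exists [seq x * h | x <- r].
  by move=> _ /mapP [x xr ->]; apply: instance_mulr => //; exact: Hr.
by rewrite big_map mulr_suml.
Qed.

(** * Factors vanishing on the diagonal *)

Lemma hom_unit_word b : hom 1%g (mono F (unit_word gT b)).
Proof.
have -> : 1%g = degw (unit_word gT b); last exact: hom_mono.
by rewrite /degw big_map big1.
Qed.

(** Exchanging two blocks of letters changes a word by a multiple of a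
    commutator. *)
Lemma perm_instance_sum s t : perm_eq s t ->
  instance_sum 1%g (mono F (unit_word gT s) - mono F (unit_word gT t)).
Proof.
move=> st; move: s t st; suff H t : forall s, perm_eq s t ->
    instance_sum 1%g (mono F (unit_word gT s) - mono F (unit_word gT t)).
  by move=> s t; exact: H.
move=> s; rewrite perm_sym => st.
pose P s := instance_sum 1%g (mono F (unit_word gT s) - mono F (unit_word gT t)).
have P0 : P t by rewrite /P subrr; exact: instance_sum0.
apply: (@catCA_perm_ind _ P _ t s st P0) => s1 s2 s3; rewrite /P => H.
rewrite -[X in X - _](subrK (mono F (unit_word gT (s1 ++ s2 ++ s3)))) -addrA.
apply: (instance_sumD _ H); apply: instance_sumI.
exists Comm, (mono F (unit_word gT s2)), (mono F (unit_word gT s1)),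
  (mono F (unit_word gT s3)).
split; rewrite ?hom_unit_word //=.
by rewrite /unit_word !map_cat !mono_cat mulrBl !mulrA.
Qed.

Lemma defect_hom (k : seq nat * X) : hom k.2.1 (defect F q k).
Proof.
case: k => b [g i]; rewrite /defect homD //=.
  by rewrite -[g in hom g _]mul1g homM ?hom_unit_word ?hom_var.
apply: homN; rewrite /push /=; case: eqP => [->|_] /=; last exact: hom0.
exact: hom_unit_word.
Qed.

Lemma deg_prod_hom (ks : seq (seq nat * X)) :
  hom (deg_prod (fun k => k.2.1) ks) (\prod_(k <- ks) defect F q k).
Proof.
rewrite /deg_prod; elim: ks => [|k ks IH]; first by rewrite !big_nil hom1.
by rewrite !big_cons homM ?defect_hom.
Qed.

(** Sorting produces commutators, and lowering an exponent from [q] to 1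
    produces x^q - x. *)
Lemma defect_instance_sum b i : instance_sum 1%g (defect F q (b, (1%g, i))).
Proof.
rewrite /defect /push /= eqxx -mono_cat.
have -> : unit_word gT b ++ [:: (1%g, i)] = unit_word gT (b ++ [:: i]).
  by rewrite /unit_word map_cat.
have b_i s : perm_eq (i :: b) s -> perm_eq (b ++ [:: i]) s.
  by rewrite -cat1s; apply: perm_trans; rewrite perm_catC.
rewrite /insert; case: ifP => [/andP [q0 /eqP ciq]|_]; last first.
  by apply: perm_instance_sum; rewrite b_i // perm_sym perm_sort.
set r := [seq j <- b | j != i].
have perm_r : perm_eq (b ++ [:: i]) (nseq q i ++ r).
  apply: b_i; rewrite -ciq /= perm_cons perm_sym.
  have /all_pred1P := filter_all (pred1 i) b; rewrite size_filter => <-.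
  exact: permEl (perm_filterC _ _).
rewrite -[X in X - _](subrK (mono F (unit_word gT (nseq q i ++ r)))) -addrA.
apply: instance_sumD; first exact: perm_instance_sum.
rewrite -[X in X - _](subrK (mono F (unit_word gT (i :: r)))) -addrA.
apply: instance_sumD; last first.
  by apply: perm_instance_sum; rewrite perm_sym perm_sort.
apply: instance_sumI; exists Power, (var F (1%g, i)), 0, (mono F (unit_word gT r)).
split; rewrite ?hom_var ?hom0 ?hom_unit_word //=; first by rewrite eqxx.
rewrite mono_cons.
have -> : mono F (unit_word gT (nseq q i ++ r)) =
    var F (1%g, i) ^+ q * mono F (unit_word gT r).
  rewrite /unit_word map_cat mono_cat map_nseq; congr (_ * _).
  elim: (q) => [|m IH] /=; first by rewrite mono_nil expr0.
  by rewrite exprS -IH mono_cons.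
by rewrite -mulrBl.
Qed.

(** If [g = 1] and the first defect has degree [h], then either [h = 1] and the
    rest is absorbed in the last factor of the instance, or the rest has degree
    [h^-1]. *)
Lemma block_instance_sum (k : seq nat * X) ks :
  instance_sum (deg_prod (fun k => k.2.1) (k :: ks))
    (\prod_(j <- k :: ks) defect F q j).
Proof.
have Hom := deg_prod_hom (k :: ks); move: Hom.
set g := deg_prod _ _ => Hom.
have [g1|g1] := eqVneq g 1%g; last first.
  apply: instance_sumI; exists (Gen g), (\prod_(j <- k :: ks) defect F q j), 1, 1.
  by rewrite /= eqxx g1 hom1; split.
rewrite g1 big_cons; case: (eqVneq k.2.1 1%g) => k1.
  have ks1 : deg_prod (fun k => k.2.1) ks = 1%g.
    by rewrite -[RHS]g1 /g /deg_prod big_cons k1 mul1g.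
  apply: instance_sum_mulr; last by rewrite -ks1 deg_prod_hom.
  by case: k k1 {g g1 Hom ks1} => b [g i] /= ->; exact: defect_instance_sum.
have ksV : deg_prod (fun k => k.2.1) ks = (k.2.1^-1)%g.
  by apply: (mulgI k.2.1); rewrite mulgV -[RHS]g1 /g /deg_prod big_cons.
apply: instance_sumI.
exists (Pair k.2.1), (defect F q k), (\prod_(j <- ks) defect F q j), 1.
by split; rewrite /= ?eqxx ?k1 ?defect_hom ?hom1 // -ksV deg_prod_hom.
Qed.

(** * Substituting into the generating identities *)

(** Dropping an argument of the wrong degree makes every family of arguments
    define a degree-preserving substitution. *)
Definition clip (arg : nat -> A) (x : X) : A :=
  if hom x.1 (arg x.2) then arg x.2 else 0.

Lemma subst_clip_var arg g i f :
  arg i = f -> hom g f -> subst (clip arg) (var F (g, i)) = f.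
Proof. by move=> Ef Hf; rewrite subst_var /clip Ef Hf. Qed.

Lemma template_instances n (fs : seq (gT * A)) :
  (forall p, p \in fs -> instance p.1 p.2) ->
  exists sl (arg : nat -> A), all2 admissible sl [seq p.1 | p <- fs] /\
    forall arg', (forall i, (3 * n <= i)%N -> arg' i = arg i) ->
      subst (clip arg') (template n sl) = \prod_(p <- fs) p.2.
Proof.
elim: fs n => [|p fs IH] n Hfs.
  exists [::], (fun=> 0); split=> // arg' _.
  by rewrite big_nil; exact: (rmorph1 (subst_lr _ (@freeAlg_scaleAr F gT))).
have [k [a [b [c [Hk Ha Hb Hc Ef]]]]] := Hfs p (mem_head _ _).
have [|sl [arg [Hsl Harg]]] := IH n.+1.
  by move=> p' pfs; apply: Hfs; rewrite inE pfs orbT.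
exists (k :: sl), (fun i => if i == (3 * n)%N then a else if i == (3 * n).+1 then b
  else if i == (3 * n).+2 then c else arg i).
split=> [|arg' Harg']; first by rewrite /= Hk.
have SM := rmorphM (subst_lr (clip arg') (@freeAlg_scaleAr F gT)).
rewrite [template _ _]/= [LHS]SM big_cons; congr (_ * _); last first.
  apply: Harg => i; rewrite mulnS => ni.
  have ni' : (3 * n + 2 < i)%N by rewrite addnC.
  rewrite Harg'; last by apply: leq_trans ni; rewrite leq_addl.
  by rewrite !gtn_eqF // (leq_trans _ ni') // ltnS ?leq_addr // addn2 // addn1.
rewrite Ef [LHS](slot_eval_morph (subst_lr (clip arg') (@freeAlg_scaleAr F gT))).
have Ea : arg' (3 * n)%N = a by rewrite Harg' // eqxx.
have Eb : arg' (3 * n).+1 = b by rewrite Harg' ?leqnSn // gtn_eqF // eqxx.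
have Ec : arg' (3 * n).+2 = c.
  have n2 : (3 * n < (3 * n).+2)%N by exact: leqW.
  by rewrite Harg' ?(ltnW n2) // (gtn_eqF n2) (gtn_eqF (leqnn _)) eqxx.
exact: (f_equal3 (slot_eval k) (subst_clip_var Ea Ha) (subst_clip_var Eb Hb)
  (subst_clip_var Ec Hc)).
Qed.

Variables (J : A -> Prop) (K : nat) (L : seq gT -> Prop).
Hypotheses (J_ideal : graded_T_ideal J)
  (J_template : forall sl gs, all2 admissible sl gs -> ~ L gs ->
     (size gs <= K)%N -> J (template 0 sl)).

Lemma J_instances (fs : seq (gT * A)) :
  (forall p, p \in fs -> instance p.1 p.2) -> ~ L [seq p.1 | p <- fs] ->
  (size fs <= K)%N -> J (\prod_(p <- fs) p.2).
Proof.
move=> Hfs nL sK; have [sl [arg [Hsl Harg]]] := template_instances 0 Hfs.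
rewrite -(Harg arg) //.
rewrite -[subst _ _]/(subst_lr (clip arg) (@freeAlg_scaleAr F gT) (template 0 sl)).
apply: (graded_T_ideal_endo J_ideal).
  apply: subst_degree_preserving => x; rewrite /clip; case: ifP => // _.
  exact: hom0.
by apply: J_template Hsl nL _; rewrite size_map.
Qed.

(** By multilinearity; [ps] are the factors already expanded. *)
Lemma J_instance_sums (ps fs : seq (gT * A)) :
  (forall p, p \in ps -> instance p.1 p.2) ->
  (forall p, p \in fs -> instance_sum p.1 p.2) ->
  ~ L [seq p.1 | p <- ps ++ fs] -> (size (ps ++ fs) <= K)%N ->
  J (\prod_(p <- ps) p.2 * \prod_(p <- fs) p.2).
Proof.
elim: fs ps => [|[g f] fs IH] ps Hps Hfs.
  by rewrite cats0 big_nil mulr1; exact: J_instances.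
have [/= r Hr ->] := Hfs _ (mem_head _ _).
move=> nL sK; rewrite big_cons /= mulr_suml mulr_sumr big_seq.
elim/big_ind: _ => [|u v|x xr]; first exact: graded_T_ideal0 J_ideal.
  exact: (fun Hu Hv => graded_T_idealD J_ideal Hu Hv).
rewrite mulrA.
have -> : \prod_(p <- ps) p.2 * x = \prod_(p <- rcons ps (g, x)) p.2.
  by rewrite big_rcons.
apply: IH => [p|p pfs||].
- by rewrite mem_rcons inE => /predU1P [->|/Hps //]; exact: Hr.
- by apply: Hfs; rewrite inE pfs orbT.
- by rewrite cat_rcons; move: nL; rewrite !map_cat.
- by move: sK; rewrite cat_rcons !size_cat.
Qed.

End Slots.

(** * The generating identities hold, and short ones suffice *)

Section FiniteBasis.
Variables (F : fieldType) (gT : finGroupType) (eps : nat -> gT).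
Variable q : nat.
Local Notation X := (gT * nat)%type.
Local Notation A := (freeAlg F gT).
Local Notation pt := (pt eps).
Local Notation graded := (graded eps).

Hypothesis expr_q : q != 0%N -> forall c : F, c ^+ q = c.

Definition realizable (gs : seq gT) : Prop :=
  exists g, embeds (fun n => g * pt n)%g 0 (pts 1%g gs).

Lemma entry_diagM (u v : UT1 F) i : entry (u * v) i i = entry u i i * entry v i i.
Proof. by rewrite entryM big_nat1. Qed.

Lemma entry_diagX (u : UT1 F) n i : entry (u ^+ n) i i = entry u i i ^+ n.
Proof.
elim: n => [|n IH]; first by rewrite !expr0 entry1 eqxx.
by rewrite !exprS entry_diagM IH.
Qed.

Lemma gradedX (u : UT1 F) n : graded 1%g u -> graded 1%g (u ^+ n).
Proof.
move=> Hu; elim: n => [|n IH]; first by rewrite expr0; exact: graded1.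
by rewrite exprS -[1%g]mulg1; exact: gradedM.
Qed.

Lemma gradedN g (u : UT1 F) : graded g u -> graded g (- u).
Proof. by rewrite -scaleN1r; exact: gradedZ. Qed.

Lemma graded_diag g (u : UT1 F) i : graded g u -> g != 1%g -> entry u i i = 0.
Proof.
move=> Hu g1; apply/eqP; apply: contraNT g1 => /Hu /(canRL (mulKg _)).
by rewrite mulVg => ->.
Qed.

(** Diagonal entries multiply, so commutators and a^q - a vanish on the
    diagonal, and so do elements of degree other than 1. *)
Lemma slot_eval_strict k g (a b c : UT1 F) :
  admissible q k g -> graded (slot_args k).1.1 a ->
  graded (slot_args k).1.2 b -> graded (slot_args k).2 c ->
  graded g (slot_eval q k a b c) /\
  forall i, entry (slot_eval q k a b c) i i = 0.
Proof.
have M1 (u v : UT1 F) : graded 1%g u -> graded 1%g v -> graded 1%g (u * v).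
  by move=> Hu Hv; rewrite -[1%g]mulg1; exact: gradedM.
case: k => [h|[h|[]]] /=.
- move=> /andP [/eqP -> g1] Ha _ _; split=> // i; exact: graded_diag Ha g1.
- move=> /andP [/eqP -> h1] Ha Hb _; split=> [|i].
    by rewrite -(mulgV h); exact: gradedM.
  by rewrite entry_diagM (graded_diag _ Ha h1) mul0r.
- move=> /eqP -> Ha Hb Hc; split=> [|i].
    by apply: (M1) => //; apply: gradedD; [|apply: gradedN]; exact: M1.
  by rewrite entry_diagM entryD entryN !entry_diagM mulrC [X in X - _]mulrC subrr mulr0.
- move=> /andP [/eqP -> q0] Ha _ Hc; split=> [|i].
    by apply: (M1) => //; apply: gradedD; [exact: gradedX|apply: gradedN].
  by rewrite entry_diagM entryD entryN entry_diagX expr_q // subrr mul0r.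
Qed.

Lemma eval_template (a : X -> UT F) n sl gs :
  (forall x, graded x.1 (UTincl (a x))) -> all2 (admissible q) sl gs ->
  exists us : seq (gT * UT1 F), [/\ [seq u.1 | u <- us] = gs,
    forall u, u \in us -> graded u.1 u.2 /\ forall i, entry u.2 i i = 0 &
    UTeval a (template F q n sl) = \prod_(u <- us) u.2].
Proof.
move=> Ha; pose ev := subst_lr (fun x => UTincl (a x)) (@scalerAr F (UT1 F)).
elim: sl n gs => [|k sl IH] n [|g gs] //=.
  by move=> _; exists [::]; split=> //; rewrite big_nil; exact: (rmorph1 ev).
move=> /andP [kg /(IH n.+1) [us [<- Hus Eus]]].
pose u x := UTincl (a x).
exists ((g, slot_eval q k (u ((slot_args k).1.1, 3 * n)%N)
  (u ((slot_args k).1.2, (3 * n).+1)) (u ((slot_args k).2, (3 * n).+2))) :: us).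
split=> //.
  move=> v; rewrite inE => /predU1P [->|/Hus //].
  by apply: slot_eval_strict => //; exact: Ha.
rewrite [LHS](rmorphM ev) big_cons -Eus; congr (_ * _).
rewrite [LHS](slot_eval_morph q ev).
exact: (f_equal3 (slot_eval q k) (subst_var _ _) (subst_var _ _) (subst_var _ _)).
Qed.

Lemma embeds_ext (p p' : nat -> gT) n w :
  p =1 p' -> embeds p n w -> embeds p' n w.
Proof.
move=> E; elim: w n => [|b w IH] n //= [m [nm <- mw]].
by exists m; split=> //; exact: IH.
Qed.

Lemma template_identity sl gs :
  all2 (admissible q) sl gs -> ~ realizable gs -> IdG eps (template F q 0 sl).
Proof.
move=> Hsl nR; apply/IdG_entry => a Ha i j.
have [us [Egs Hus ->]] := eval_template 0 Ha Hsl.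
apply/eqP; apply: contraT => /(strict_product_embeds Hus); rewrite Egs => emb.
case: nR; exists (pt i)^-1%g; apply: (@embeds_leq _ _ 0 i) => //.
by rewrite -(mulVg (pt i)) -map_pts; exact: embeds_translate.
Qed.

(** Shorten the sequence of partial degrees to a bad subsequence of length at
    most [K]; cutting there groups the defects into blocks, and the factors
    before the first and after the last cut are absorbed by the ideal. *)
Lemma defects_in_ideal (J : A -> Prop) (K : nat) :
  graded_T_ideal J ->
  (forall w, (forall g, ~ embeds (fun n => g * pt n)%g 0 w) ->
     exists v, [/\ subseq v w, (size v <= K)%N &
       forall g, ~ embeds (fun n => g * pt n)%g 0 v]) ->
  (forall sl gs, all2 (admissible q) sl gs -> ~ realizable gs ->
     (size gs <= K)%N -> J (template F q 0 sl)) ->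
  forall ks : seq (seq nat * X),
  ~ realizable [seq k.2.1 | k <- ks] -> J (\prod_(k <- ks) defect F q k).
Proof.
move=> Jideal short Jtemplate ks nR.
have [|v [vw sv nv]] := short (pts 1%g [seq k.2.1 | k <- ks]).
  by move=> g Hg; apply: nR; exists g.
case: v vw sv nv => [|a s] vw sv nv; first by case: (nv 1%g).
have [pre [rest [Eks _ /subseq_pts_blocks [bls [post [Erest Hbls]]]]]] :=
  subseq_pts_split vw.
rewrite Eks Erest !big_cat /=.
apply: (graded_T_ideal_mull Jideal); apply: (graded_T_ideal_mulr Jideal).
rewrite big_flatten /= big_map.
pose fs := [seq (deg_prod (fun k => k.2.1) (b.1 :: b.2),
  \prod_(k <- b.1 :: b.2) defect F q k) | b <- bls].
have -> : \prod_(b <- bls) \prod_(k <- b.1 :: b.2) defect F q k =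
    \prod_(p <- [::] : seq (gT * A)) p.2 * \prod_(p <- fs) p.2.
  by rewrite big_nil mul1r big_map.
have Efs : [seq p.1 | p <- fs] = quotients a s.
  by rewrite -Hbls /fs -map_comp.
have sfs : size fs = size s.
  by rewrite -[LHS](size_map (fun p => p.1)) Efs size_pairmap.
apply: (J_instance_sums Jideal Jtemplate) => //.
- by move=> _ /mapP [[k r] _ ->]; exact: block_instance_sum.
- rewrite cat0s Efs => -[g]; rewrite pts_quotients => emb.
  apply: (nv (a * g)%g).
  have := embeds_translate a emb; rewrite -map_comp.
  rewrite (eq_map (_ : _ =1 id)) ?map_id; last by move=> b /=; rewrite mulKVg.
  by apply: embeds_ext => n; rewrite mulgA.
- by rewrite cat0s sfs ltnW.
Qed.

End FiniteBasis.

(** [P] is not assumed decidable, so a finite list is filtered by excluded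
    middle on each member. *)
Lemma finite_templates (F : fieldType) (gT : finGroupType) (q K : nat)
    (P : freeAlg F gT -> Prop) :
  exists S : seq (freeAlg F gT), (forall s, s \in S -> P s) /\
    forall sl, (size sl <= K)%N -> P (template F q 0 sl) -> template F q 0 sl \in S.
Proof.
pose cand := flatten [seq [seq template F q 0 (tval t) | t : n.-tuple (slot gT)]
  | n <- iota 0 K.+1].
suff [S HS] : exists S : seq (freeAlg F gT), forall s, s \in S <-> s \in cand /\ P s.
  exists S; split=> [s /HS [] //|sl sK Psl]; apply/HS; split=> //.
  apply/flattenP; exists [seq template F q 0 (tval t) | t : (size sl).-tuple (slot gT)].
    by apply/mapP; exists (size sl); rewrite ?mem_iota.
  by apply/mapP; exists (in_tuple sl); rewrite ?mem_enum.
elim: cand => [|c r [S HS]]; first by exists [::] => s; split=> // -[].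
have [Pc|nPc] := classic (P c).
  exists (c :: S) => s; rewrite !inE; split.
    by move=> /predU1P [->|/HS [-> Ps]]; rewrite ?eqxx ?orbT.
  by move=> [/predU1P [->|sr] Ps]; rewrite ?eqxx //; apply/orP; right; apply/HS.
exists S => s; rewrite inE; split=> [/HS [-> Ps]|[/predU1P [->|sr] Ps]] //.
  by rewrite orbT.
by apply/HS.
Qed.

Theorem theorem5p3 (F : fieldType) (gT : finGroupType) (eps : nat -> gT) :
  exists S : seq (freeAlg F gT), forall f : freeAlg F gT,
    IdG eps f <-> graded_T_ideal_gen (fun s => s \in S) f.
Proof.
have [q [q1 expr_q poly_vanish]] := field_exponent F.
have [K short] := short_common_nonembedding (fun g n => g * pt eps n)%g.
have [S [S_id S_template]] := @finite_templates F gT q K (IdG eps).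
exists S => f; split=> [If|Hf]; last exact: (Hf _ (IdG_graded_T_ideal F eps)).
pose J := graded_T_ideal_gen (fun s => s \in S).
have Jideal : graded_T_ideal J := graded_T_ideal_genP _.
have Jdefects := defects_in_ideal Jideal short.
pose s := [seq (f@_w, fmonom_val w) | w <- msupp f].
have -> : f = \prod_(k <- [::] : seq (seq nat * (gT * nat))) defect F q k * lin_eval s.
  by rewrite big_nil mul1r /lin_eval big_map -monoE.
apply: (@path_coef_kernel F gT q expr_q q1 poly_vanish (realizable eps) J _ _ _ _
  (\max_(t <- s) size t.2).+1).
- exact: graded_T_ideal0 Jideal.
- by move=> u v; exact: graded_T_idealD.
- by move=> u v; exact: graded_T_ideal_mulr.
- apply: Jdefects => sl gs Hsl nR sK II HI HS.
  apply: HS; apply: S_template; last exact: template_identity Hsl nR.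
  by move: Hsl; rewrite all2E => /andP [/eqP -> _].
- by move=> t ts; rewrite ltnS; exact: leq_bigmax_seq.
move=> d ys [g emb]; rewrite /lin_coef big_map.
exact: IdG_path_coef emb.
Qed.
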